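(* Let $\Pi_n$ be Gnedin's partition of $[n]$ with parameters $(\gamma,\zeta)$, where $\gamma\ge0$ and $j^2-\gamma j+\zeta>0$ for all integers $j\ge1$, and let $|A_{(|\Pi_n|)}|$ be its smallest block size. Let $z_1,z_2,s_1,s_2$ be such that $z_1z_2=s_1s_2=\zeta$ and $z_1+z_2=-(s_1+s_2)=\gamma$. Then $$\mathbb{P}(|A_{(|\Pi_n|)}|\ge r)\sim B(z_1,z_2)\sum_{m=1}^{\lfloor x^{-1}\rfloor}\frac{(s_1)_m(s_2)_m}{m!(m-1)!}(1-mx)^{m-1},\qquad n,r\to\infty,\ r\sim xn.$$ Moreover, for $j=1,2,\dots$, $$\mathbb{E}\left(\frac{[|A_{(|\Pi_n|)}|]_j}{n^j}\right)\sim j!\,B(z_1,z_2)\sum_{m=1}^\infty\frac{(s_1)_m(s_2)_m}{m!(m+j-1)!\,m^j}=\mathbb{E}\left\{|\Pi_\infty|^{-j}\binom{|\Pi_\infty|+j-1}{j}^{-1}\right\},\qquad n\to\infty,$$ where $|\Pi_\infty|=\lim_{n\to\infty}|\Pi_n|$ has the distribution $$\mathbb{P}(|\Pi_\infty|=m)=B(z_1,z_2)\frac{(s_1)_m(s_2)_m}{m!(m-1)!},\qquad m=1,2,\dots$$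
   Context: Notation: $(x)_i=x(x+1)\cdots(x+i-1)$, $(x)_0=1$; $[x]_i=x(x-1)\cdots(x-i+1)$, $[x]_0=1$; $B(z_1,z_2)=\Gamma(z_1)\Gamma(z_2)/\Gamma(z_1+z_2)$ is the Beta function. Gnedin's partition with parameters $(\gamma,\zeta)$, where $\gamma\ge0$ and $j^2-\gamma j+\zeta>0$ for all integers $j\ge1$, is the exchangeable random partition $\Pi_n$ of $[n]=\{1,\dots,n\}$ in which each partition of $[n]$ with blocks of sizes $n_1,\dots,n_k$ has probability $v_{n,k}\prod_{j=1}^k(2)_{n_j-1}=v_{n,k}\prod_{j=1}^k n_j!$, with $$v_{n,k}=(\gamma)_{n-k}\frac{\prod_{j=1}^{k-1}(j^2-\gamma j+\zeta)}{\prod_{j=1}^{n-1}(j^2+\gamma j+\zeta)}.$$ $|\Pi_n|$ is the number of blocks, and $|A_{(1)}|\ge\cdots\ge|A_{(|\Pi_n|)}|$ are the block sizes in descending order, so $|A_{(|\Pi_n|)}|$ is the smallest.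
   Formalization: For x=1 the tail asymptotics assumes r≤n eventually; for γ=0, j=1 the moment claim is only convergence to 0 (there E/n=1/n, constant 0), and for γ=0 finiteness of |Π_∞| is not claimed (it is infinite); for ζ=0 the product B(z1,z2)(s1)_m(s2)_m is read by continuity. *)

(* Defs.v *)
From mathcomp Require Import all_boot all_order all_algebra.
From mathcomp Require Import complex.
From mathcomp Require Import all_classical all_reals all_analysis.
Import Order.TTheory GRing.Theory Num.Theory numFieldNormedType.Exports.

Set Implicit Arguments.
Unset Strict Implicit.
Unset Printing Implicit Defensive.

Local Open Scope ring_scope.
Local Open Scope complex_scope.

Definition poch (A : pzRingType) (x : A) (m : nat) : A :=
  \prod_(i < m) (x + i%:R).

Section ComplexGamma.
Variable R : realType.
Implicit Types z s : R[i].

(* n ^ z = exp (z ln n) *)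
Definition cpow_nat (n : nat) z : R[i] :=
  let l := ln (n%:R : R) in
  (expR (complex.Re z * l))%:C
  * (cos (complex.Im z * l) +i* sin (complex.Im z * l)).

Definition gauss_gamma z (n : nat) : R[i] :=
  n`!%:R * cpow_nat n z / \prod_(i < n.+1) (z + i%:R).

(* Gauss's limit formula, valid at every z other than 0, -1, -2, ...; at these
   poles a factor of the product vanishes, so that cGamma z = 0 and hence
   (cGamma z)^-1 = 0, which is the value there of the entire function 1/Gamma *)
Definition cGamma z : R[i] :=
  limn (fun n => complex.Re (gauss_gamma z n))
  +i* limn (fun n => complex.Im (gauss_gamma z n)).

Definition cBeta z1 z2 : R[i] := cGamma z1 * cGamma z2 / cGamma (z1 + z2).

(* B(z1,z2) (s1)_m (s2)_m for m >= 1 and z1 z2 = s1 s2. When z1 z2 = 0 the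
   pole of B is cancelled by the zero of (s1)_m (s2)_m, and the product is read
   by continuity: for z1 z2 = s1 s2 != 0, Gamma(z) = Gamma(1 + z) / z and
   (s)_m = s (1 + s)_(m-1) turn the second formula into the first. *)
Definition beta_poch z1 z2 s1 s2 (m : nat) : R[i] :=
  if z1 * z2 == 0 then
    cGamma (1 + z1) * cGamma (1 + z2) / cGamma (z1 + z2)
    * (poch (1 + s1) m.-1 * poch (1 + s2) m.-1)
  else cBeta z1 z2 * (poch s1 m * poch s2 m).

End ComplexGamma.

(* The default n is never smaller than a block. *)
Definition min_block (n : nat) (pi : {set {set 'I_n}}) : nat :=
  \big[minn/n]_(B in pi) #|B|.

Definition restrict_partition (n : nat) (pi : {set {set 'I_n.+1}}) :
    {set {set 'I_n}} :=
  (([set widen_ord (leqnSn n) @^-1: B | B : {set 'I_n.+1} in pi]) :\ finset.set0)%SET.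

Definition gnedin_v (R : realType) (gamma zeta : R) (n k : nat) : R :=
  poch gamma (n - k)
  * (\prod_(1 <= j < k) (j%:R ^+ 2 - gamma * j%:R + zeta))
  / (\prod_(1 <= j < n) (j%:R ^+ 2 + gamma * j%:R + zeta)).

Definition gnedin_prob (R : realType) (gamma zeta : R) (n : nat)
    (pi : {set {set 'I_n}}) : R :=
  gnedin_v gamma zeta n #|pi|
  * \prod_(B in pi) poch (2 : R) (#|B| - 1)%N.

Definition set_partition (n : nat) (pi : {set {set 'I_n}}) : bool :=
  finset.partition pi [set: 'I_n]%SET.

Local Open Scope classical_set_scope.

(* The partitions Pi_n of {0, ..., n-1} are the restrictions of one random
   partition of the natural numbers, so that lim_n |Pi_n| makes sense. *)
Definition gnedin_partition (R : realType) (d : measure_display)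
    (T : measurableType d) (P : probability T R) (gamma zeta : R)
    (Pi : forall n : nat, T -> {set {set 'I_n}}) : Prop :=
  [/\ forall n t, set_partition (Pi n t),
      forall n t, Pi n t = restrict_partition (Pi n.+1 t),
      forall n (pi : {set {set 'I_n}}), measurable [set t | Pi n t = pi]
    & forall n (pi : {set {set 'I_n}}), (0 < n)%N -> set_partition pi ->
        P [set t | Pi n t = pi] = (gnedin_prob gamma zeta pi)%:E].

Definition nblocks_lim (R : realType) (T : Type)
    (Pi : forall n : nat, T -> {set {set 'I_n}}) (t : T) : \bar R :=
  limn (fun n => (#|Pi n t|%:R : R)%:E).

(* k^(-j) / binomial(k + j - 1, j), with value 0 at k = +oo *)
Definition inv_pow_bin (R : realType) (j : nat) (k : \bar R) : R :=
  if k is r%:E then r ^- j * ('C(Num.truncn r + j - 1, j)%:R)^-1 else 0.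

(* Main.v *)
(** Given the number k of its blocks, the partition of [n] has block sizes
    distributed as a uniform composition of n into k parts, so
    P(|Pi_n| = k, min >= r) = v_{n,k} (n! / k!) C(n - 1 - k (r - 1), k - 1).
    For fixed k one has v_{n,k} n! n^(k-1) -> A prod_{1 <= j < k} (j^2 - gamma j + zeta),
    where A = Gamma(1 + z1) Gamma(1 + z2) / Gamma(gamma) comes from Gauss's product;
    the tail asymptotics follow because only k <= 1 / x contribute.
    For the moments, E [min]_j is a convolution of binomial coefficients whose
    leading order is exact, and min <= n / k makes large k negligible.
    The limit law of |Pi_n| is read off from the same asymptotics.  It has mass 1
    when gamma > 0 by Gauss's summation theorem, proved by contiguity: the series
    S_N = 2F1(1 + s1, 1 + s2; N + 2; 1) satisfies S_N = r_N S_(N+1) and S_N >= 1,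
    and the product of the r_N tends to 1 / A. *)

Require Import Defs.
From mathcomp Require Import all_boot all_order all_algebra.
From mathcomp Require Import complex.
From mathcomp Require Import all_classical all_reals all_analysis.
From mathcomp Require Import measurable_realfun.
From mathcomp Require Import zify ring lra.
Import Order.TTheory GRing.Theory Num.Theory numFieldNormedType.Exports.
Local Open Scope classical_set_scope.
Local Open Scope complex_scope.
Local Open Scope ring_scope.
Set Implicit Arguments.
Unset Strict Implicit.
Unset Printing Implicit Defensive.

(** * Counting partitions by block sizes *)

(** Boundary cases shape the argument. Equivalence to a constant says more than convergence only if
    that constant is 0, and then it asks for eventual equality. This occurs for x > 1, where the sum
    is empty, and for gamma = 0, where A = 0: (0)_(n-k) vanishes unless k = n, all blocks are
    singletons, and the first moment 1 / n is not eventually 0, whence the restriction to j > 1. At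
    x = 1 / k, r ~ x n does not decide whether k r <= n; for k >= 2 the factor (1 - k x)^(k-1)
    vanishes there, but for k = 1 it is 0^0 = 1 and r <= n has to be assumed. As z1 and z2 may be
    non-real conjugates, Gauss's product must be shown to have a nonzero limit at complex arguments;
    its relative increments are O(1 / n^2). Afterwards only the real products (z1 + j) (z2 + j) and
    (s1 + j) (s2 + j) occur. Domination is inherited from P: the probabilities of the numbers of
    blocks sum to 1, which bounds the tails in the moments, and the partial sums of the limit law
    are probabilities. Gauss's theorem therefore only has to supply A S_0 >= 1. *)

Section combinatorics.
Import mathcomp.boot.finset.
Local Open Scope nat_scope.

(* Sum of phi(n_1) ... phi(n_k) over the compositions n = n_1 + ... + n_k. *)
Fixpoint comp_weight (phi : nat -> nat) (k n : nat) : nat :=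
  if k is k'.+1 then \sum_(1 <= b < n.+1) phi b * comp_weight phi k' (n - b)
  else n == 0.

(* Double counting of the pairs (partition, marked block). *)
Lemma sum_partition_mark (T : finType) (S : {set T}) (k : nat)
    (f : nat -> nat) :
  k.+1 * \sum_(P : {set {set T}} | partition P S && (#|P| == k.+1))
           \prod_(B in P) f #|B|
  = \sum_(B : {set T} | (B \subset S) && (B != set0))
      f #|B| * \sum_(P : {set {set T}} | partition P (S :\: B) && (#|P| == k))
                 \prod_(B in P) f #|B|.
Proof.
under [RHS]eq_bigr => B _ do rewrite big_distrr /=.
rewrite (exchange_big_dep predT) //= big_distrr /=.
transitivity (\sum_(P : {set {set T}} | partition P S && (#|P| == k.+1))
                \sum_(B in P) \prod_(B in P) f #|B|).
  by apply: eq_bigr => P /andP[_ /eqP cP]; rewrite sum_nat_const cP.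
rewrite (exchange_big_dep (fun B : {set T} => (B \subset S) && (B != set0))) /=; last first.
  move=> P B /andP[Pp _] BP; rewrite (partitionS Pp BP).
  by rewrite (partition_neq0 Pp BP).
rewrite [RHS](exchange_big_dep (fun B : {set T} => (B \subset S) && (B != set0))) /=; last first.
  by move=> P B _ /andP[].
apply: eq_bigr => B /andP[BS B0].
(* Adding the marked block inverts its removal; a nonempty [B] cannot already belong to a partition
   of [S :\: B]. *)
rewrite (reindex_onto (fun P => B |: P) (fun P => P :\ B)) /=; last first.
  by move=> P /andP[_ BP]; rewrite setD1K.
have key P : partition P (S :\: B) && (#|P| == k) ->
    B \notin P.
  move=> /andP[Pp _]; apply/negP => BP.
  have := partitionS Pp BP; rewrite subsetD => /andP[_].
  by rewrite -setI_eq0 setIid (negbTE B0).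
apply: esym; rewrite big_mkcond [RHS]big_mkcond /=; apply: eq_bigr => P _.
rewrite BS B0 setU11 !andbT.
case: ifPn => [/andP[_ Pk]|]; last rewrite andTb.
  have BP : B \notin P by exact: key.
  have [Pp cP] := andP Pk.
  have PU : partition (B |: P) S.
    rewrite -(setID S B) (setIidPr BS); apply: partitionU1 => //.
    by rewrite -setI_eq0; apply/eqP/setP => x; rewrite !inE; case: (x \in B); rewrite ?andbF.
  rewrite PU cardsU1 BP (eqP cP) eqxx setU1K // eqxx /=.
  by rewrite big_setU1.
case: ifPn => // /andP[/andP[Pp cP] /eqP e] /negP; case.
have BP : B \notin P by rewrite -e !inE eqxx.
move: cP; rewrite cardsU1 BP eqSS => ->; rewrite andbT -e.
by apply: partitionD1 => //; rewrite setU11.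
Qed.

(** A marked block of size b can be chosen in C(n, b) ways, and its weight b! together with the (n -
    b)! of the remaining points gives n!. The weights b! thus turn labelled set partitions into
    unlabelled compositions, the k! accounting for the order of the parts. *)
Lemma sum_partition_fact (T : finType) (phi : nat -> nat) (k : nat)
    (S : {set T}) : phi 0 = 0 ->
  k`! * \sum_(P : {set {set T}} | partition P S && (#|P| == k))
           \prod_(B in P) (phi #|B| * (#|B|)`!)
  = (#|S|)`! * comp_weight phi k #|S|.
Proof.
move=> phi0; elim: k S => [|k IH] S.
  rewrite fact0 mul1n /=; have [S0|S0] := eqVneq #|S| 0; rewrite ?muln0 ?S0.
    rewrite (eq_bigl (pred1 finset.set0)) ?big_pred1_eq ?big_set0 // => P /=.
    rewrite cards_eq0 (cards0_eq S0) partition_set0 andbb //.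
  rewrite big_pred0 // => P; apply/negP => /andP[/card_partition cP].
  rewrite cards_eq0 => /eqP P0; move: cP S0; rewrite P0 big_set0 => ->.
  by rewrite eqxx.
rewrite factS [_ * k`!]mulnC -mulnA.
rewrite (@sum_partition_mark T S k (fun b => phi b * b`!)) big_distrr /=.
pose F b := phi b * b`! * ((#|S| - b)`! * comp_weight phi k (#|S| - b)).
transitivity (\sum_(B : {set T} | (B \subset S) && (B != finset.set0)) F #|B|).
  by apply: eq_bigr => B /andP[BS _]; rewrite mulnCA IH cardsDS.
(* The empty set may be readmitted because [phi 0 = 0]; the subsets can then be grouped by
   cardinality. *)
transitivity (\sum_(B : {set T} | B \subset S) F #|B|).
  rewrite [RHS]big_mkcond [LHS]big_mkcond; apply: eq_bigr => B _.
  case: ifPn => [/andP[-> //]|]; case: ifP => //= _ /negbNE/eqP ->.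
  by rewrite /F cards0 phi0.
rewrite (partition_big (fun B : {set T} => inord #|B| : 'I_#|S|.+1) xpredT) //=.
rewrite (eq_bigr (fun b : 'I_#|S|.+1 => 'C(#|S|, b) * F b)); last first.
  move=> b _; rewrite -cards_draws -sum_nat_const.
  rewrite [LHS]big_mkcond [RHS]big_mkcond; apply: eq_bigr => B _.
  rewrite inE; case: (boolP (B \subset S)) => //= BS.
  have Bn : #|B| < #|S|.+1 by rewrite ltnS subset_leq_card.
  have -> : (inord #|B| == b :> 'I_#|S|.+1) = (#|B| == b).
    by rewrite -val_eqE /= inordK.
  by case: eqP => // ->.
rewrite big_distrr /= -(big_mkord predT (fun b => 'C(#|S|, b) * F b)).
rewrite [LHS]big_ltn // {1}/F phi0 !mul0n muln0 add0n.
apply: eq_big_nat => b /andP[_ bn].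
rewrite /F -(bin_fact (_ : b <= #|S|)) //; nia.
Qed.

(** Classify the subsets of N + 1 points with a + b + 1 elements by the position t of the element
    number a + 1. *)
Lemma sum_bin_upper (a b N : nat) :
  \sum_(0 <= t < N.+1) 'C(t, a) * 'C(N - t, b) = 'C(N.+1, (a + b).+1).
Proof.
elim: N b => [|N IH] b.
  by rewrite big_nat1 sub0n; case: a b => [|a] [|b]; rewrite ?bin0n.
case: b => [|b].
  have e M : \sum_(0 <= t < M) 'C(t, a) = 'C(M, a.+1).
    elim: M => [|M IHM]; first by rewrite big_geq.
    by rewrite big_nat_recr //= IHM binS addnC.
  under eq_bigr => t _ do rewrite bin0 muln1.
  by rewrite e addn0.
rewrite big_nat_recr //= subnn bin0n muln0 addn0.
transitivity (\sum_(0 <= t < N.+1) ('C(t, a) * 'C(N - t, b.+1) + 'C(t, a) * 'C(N - t, b))).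
  by apply: eq_big_nat => t /andP[_ tN]; rewrite subSn // binS mulnDr.
by rewrite big_split /= !IH [RHS]binS !addnS.
Qed.

(** Stars and bars after removing r - 1 from every part. The indicator rejects n < r when k = 0,
    where the binomial coefficient is always 1. *)
Lemma comp_weight_ge (r k n : nat) : 0 < r ->
  comp_weight (fun b => r <= b) k.+1 n
  = (k.+1 * r <= n) * 'C(n.-1 - k.+1 * r.-1, k).
Proof.
move=> r0; elim: k n => [|k IH] n.
  rewrite /= mul1n bin0 muln1.
  have [rn|nr] := leqP r n.
    have n0 : 0 < n by apply: leq_trans rn.
    rewrite big_nat_recr //= rn subnn eqxx big1_seq ?addn0 //.
    move=> b /andP[_]; rewrite mem_index_iota => /andP[_ bn].
    by rewrite subn_eq0 [n <= b]leqNgt bn muln0.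
  rewrite big1_seq // => b /andP[_]; rewrite mem_index_iota ltnS => /andP[_ bn].
  by rewrite leqNgt (leq_ltn_trans bn nr).
transitivity (\sum_(1 <= b < n.+1) (r <= b) * comp_weight (fun b => r <= b) k.+1 (n - b)).
  by [].
under eq_bigr => b _ do rewrite IH.
have [kn|nk] := leqP (k.+2 * r) n; last first.
  rewrite mul0n big1_seq // => b _.
  have [rb /=|//] := leqP r b.
  suff -> : (k.+1 * r <= n - b) = false by [].
  by apply/negbTE; rewrite -ltnNge; move: nk; rewrite mulSn; nia.
rewrite mul1n.
rewrite (big_cat_nat (n := r)) //=; last by nia.
rewrite big1_seq ?add0n; last first.
  move=> b /andP[_]; rewrite mem_index_iota => /andP[_ br].
  by rewrite leqNgt br.
rewrite -[r]add0n big_addn !add0n.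
have [M eM] : exists M, n.-1 - k.+2 * r.-1 = M.+1.
  by exists (n.-1 - k.+2 * r.-1).-1; rewrite prednK //; nia.
have en : n = M.+2 + k.+2 * r.-1 by lia.
rewrite eM -(sum_bin_upper 0 k M) (big_cat_nat (n := M.+1)) //=; last by nia.
rewrite [X in _ + X]big1_seq ?addn0; last first.
  move=> i /andP[_]; rewrite mem_index_iota => /andP[Mi _].
  suff -> : (k.+1 * r <= n - (i + r)) = false by rewrite mul0n muln0.
  by apply/negbTE; rewrite -ltnNge; nia.
apply: eq_big_nat => i /andP[_ iM]; rewrite leq_addl bin0 !mul1n.
have -> : (n - (i + r)).-1 - k.+1 * r.-1 = M - i by nia.
case: (leqP k (M - i)) => kM; last by rewrite bin_small ?muln0.
suff -> : k.+1 * r <= n - (i + r) by rewrite mul1n.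
by nia.
Qed.

Lemma sum_nat_blocks (F : nat -> nat) (k L : nat) :
  \sum_(0 <= t < L * k) F t
  = \sum_(0 <= s < L) \sum_(0 <= i < k) F (k * s + i).
Proof.
elim: L => [|L IH]; first by rewrite !big_geq.
rewrite [RHS]big_nat_recr //= -IH mulSnr (big_cat_nat (n := L * k)) //=; last first.
  by rewrite leq_addr.
congr (_ + _); rewrite -[X in \sum_(X <= _ < _) _]add0n big_addn addKn.
by apply: eq_bigr => i _; rewrite addnC mulnC.
Qed.

Lemma leq_expn_ffact (k s a : nat) : k ^ a * s ^_ a <= (k * s) ^_ a.
Proof.
elim: a => [|a IH] //; rewrite !ffactnSr expnS.
rewrite [k * k ^ _]mulnC mulnACA leq_mul // mulnBr; case: k {IH} => [|k] //.
by rewrite leq_sub2l // leq_pmull.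
Qed.

(** Each factor satisfies k s + i - b <= k (s + 1) <= k (s + a - b) for b < a; the shift of s by a
    absorbs the remainder i. *)
Lemma leq_ffact_expn (k s i a : nat) : i < k ->
  (k * s + i) ^_ a <= k ^ a * (s + a) ^_ a.
Proof.
move=> ik; suff H b : b <= a -> (k * s + i) ^_ b <= k ^ b * (s + a) ^_ b by exact: H.
elim: b => [|b IH] // ba; rewrite !ffactnSr expnS.
rewrite [k * k ^ _]mulnC mulnACA; apply: leq_mul; first by apply: IH; lia.
have [c ->] : exists c, a = b + c.+1 by exists (a - b).-1; lia.
have -> : s + (b + c.+1) - b = s + c.+1 by lia.
rewrite mulnDr mulnS; lia.
Qed.

(* The next two bounds compare this sum, up to the factor k ^ a.+1, with
   sum_bin_upper by writing t = k s + i, 0 <= i < k; it is the number of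
   compositions into k parts weighted by a binomial moment of the least part. *)
Definition comb_conv (a b k M : nat) : nat :=
  \sum_(0 <= s < (M %/ k).+1) 'C(s, a) * 'C(M - k * s, b).

Lemma comb_conv_ub (a b k M : nat) : 0 < k ->
  k ^ a.+1 * comb_conv a b k M <= 'C((M + k).+1, (a + b).+1).
Proof.
move=> k0; rewrite -sum_bin_upper.
rewrite (big_cat_nat (n := (M %/ k).+1 * k)) //=; last first.
  by rewrite mulSn; have := leq_trunc_div M k; lia.
apply: leq_trans (leq_addr _ _).
rewrite sum_nat_blocks big_distrr /= !big_mkord; apply: leq_sum => s _.
rewrite expnS -mulnA big_mkord.
rewrite [leqLHS](_ : _ = \sum_(i < k) k ^ a * ('C(s, a) * 'C(M - k * s, b))); last by rewrite sum_nat_const card_ord.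
apply: leq_sum => i _; rewrite mulnA leq_mul //.
  apply: leq_trans (leq_bin2l a (leq_addr i (k * s))).
  by rewrite -(leq_pmul2r (fact_gt0 a)) -mulnA !bin_ffact leq_expn_ffact.
by apply: leq_bin2l; have := ltn_ord i; lia.
Qed.

Lemma comb_conv_lb (a b k M : nat) : 0 < k -> k * a <= M ->
  'C((M - k * a).+1, (a + b).+1) <= k ^ a.+1 * comb_conv a b k M.
Proof.
move=> k0 kaM; rewrite -sum_bin_upper; set N := M - k * a.
have NL : N.+1 <= (N %/ k).+1 * k by rewrite mulSn; have := divn_eq N k; have := ltn_pmod N k0; lia.
apply: (@leq_trans (\sum_(0 <= t < (N %/ k).+1 * k) 'C(t, a) * 'C(N - t, b))).
  by rewrite [leqRHS](big_cat_nat (n := N.+1)) //= leq_addr.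
rewrite sum_nat_blocks /comb_conv.
have aL : a <= (M %/ k).+1.
  by rewrite ltnW // ltnS leq_divRL // mulnC.
(* Dropping s < a and shifting s by a produces the C(s + a, a) demanded by [leq_ffact_expn]; the
   price is the k a subtracted from M. *)
rewrite [X in _ <= _ * X](big_cat_nat (n := a)) //=.
rewrite mulnDr; apply: leq_trans (leq_addl _ _).
rewrite [X in _ * X](_ : _ = \sum_(0 <= s < (M %/ k).+1 - a)
    'C(s + a, a) * 'C(M - k * (s + a), b)); last first.
  by rewrite -[X in \sum_(X <= _ < _) _]add0n big_addn.
have -> : (M %/ k).+1 - a = (N %/ k).+1.
  have -> : M = a * k + N by rewrite /N; lia.
  by rewrite divnMDl // -addnS addKn.
rewrite big_distrr /= !big_mkord; apply: leq_sum => s _.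
rewrite expnS -mulnA big_mkord.
rewrite [leqRHS](_ : _ = \sum_(i < k) k ^ a * ('C(s + a, a) * 'C(M - k * (s + a), b))); last by rewrite sum_nat_const card_ord.
apply: leq_sum => i _; rewrite mulnA leq_mul //.
  by rewrite -(leq_pmul2r (fact_gt0 a)) -mulnA !bin_ffact leq_ffact_expn.
by apply: leq_bin2l; rewrite mulnDr /N; lia.
Qed.

End combinatorics.

Lemma poch2 (R : realType) (m : nat) : poch (2 : R) (m - 1) = m`!%:R.
Proof.
case: m => [|m]; first by rewrite /poch big_ord0.
rewrite subn1 /=; elim: m => [|m IH]; first by rewrite /poch big_ord0.
rewrite /poch big_ord_recr /= -/(poch _ _) IH [in RHS]factS natrM mulrC.
by congr (_ * _); rewrite -natrD.
Qed.

Lemma min_block_leq (n : nat) (pi : {set {set 'I_n}}) : (min_block pi <= n)%N.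
Proof. by rewrite /min_block; elim/big_rec: _ => // B m _ mn; rewrite geq_min mn orbT. Qed.

Lemma leq_min_block (n r : nat) (pi : {set {set 'I_n}}) : (0 < n)%N ->
  set_partition pi ->
  (r <= min_block pi)%N = [forall B in pi, r <= #|B|]%N.
Proof.
move=> n0 pip.
(* Since n > 0 some block exists, so r <= #|B0| <= n; this is what the default value n of the
   minimum requires. *)
have [B0 B0pi] : exists B0, B0 \in pi.
  have : Ordinal n0 \in finset.cover pi by rewrite (cover_partition pip) inE.
  by move=> /finset.bigcupP[B Bpi _]; exists B.
apply/idP/forall_inP => [h B Bpi|h].
  apply: leq_trans h _; rewrite /min_block.
  elim: (index_enum _) (mem_index_enum B) => // C s IH.
  rewrite inE big_cons => /predU1P[<-|/IH]; first by rewrite Bpi geq_minl.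
  by case: ifP => // _; apply: leq_trans (geq_minr _ _).
rewrite /min_block; elim/big_ind: _ => //.
  apply: leq_trans (h _ B0pi) _.
  by rewrite -[leqRHS](card_ord n) max_card.
by move=> a b ra rb; rewrite leq_min ra.
Qed.

(** As (2)_(b-1) = b!, the probability of a partition is v times the weight of [sum_partition_fact],
    and the condition on the least block is a product over blocks of the indicators [phi]. *)
Lemma gnedin_prob_sum (R : realType) (gamma zeta : R) (n k r : nat) :
  (0 < n)%N -> (0 < r)%N ->
  \sum_(pi : {set {set 'I_n}} |
        set_partition pi && (#|pi| == k.+1) && (r <= min_block pi)%N)
     gnedin_prob gamma zeta pi
  = gnedin_v gamma zeta n k.+1 * (n`!%:R / (k.+1)`!%:R)
    * ((k.+1 * r <= n)%N%:R * 'C(n.-1 - k.+1 * r.-1, k)%:R).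
Proof.
move=> n0 r0; rewrite -natrM -(@comp_weight_ge r k n r0).
set phi := fun b : nat => nat_of_bool (r <= b)%N.
have phi0 : phi 0 = 0%N by rewrite /phi leqNgt r0.
set S := (\sum_(P : {set {set 'I_n}} | finset.partition P [set: 'I_n] && (#|P| == k.+1))
            \prod_(B in P) (phi #|B| * (#|B|)`!))%N.
rewrite -mulrA; have -> : n`!%:R / (k.+1)`!%:R * (comp_weight phi k.+1 n)%:R = S%:R :> R.
  have := @sum_partition_fact 'I_n phi k.+1 [set: 'I_n]%SET phi0.
  rewrite cardsT card_ord -/S mulrAC -natrM => <-.
  by rewrite natrM mulrAC divff ?mul1r // pnatr_eq0 -lt0n fact_gt0.
rewrite /S natr_sum mulr_sumr [LHS]big_mkcond [RHS]big_mkcond /=.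
apply: eq_bigr => pi _; rewrite -/(set_partition pi).
have [pip|//] := boolP (set_partition pi).
have [pk|//] := eqVneq #|pi| k.+1.
rewrite leq_min_block //=; case: ifPn => [/forall_inP h|].
  rewrite /gnedin_prob pk; congr (_ * _).
  rewrite natr_prod; apply: eq_bigr => B Bpi.
  by rewrite /phi h // mul1n poch2.
rewrite negb_forall_in => /exists_inP[B Bpi rB].
by rewrite (bigD1 B) //= /phi (negbTE rB) !mul0n mulr0.
Qed.

(** * Limits of the finite-n formulas *)

Section limits.
Context {R : realType} {T : Type} {F : set_system T} {FF : Filter F}.

Lemma cvg_sumR (I : Type) (r : seq I) (P : pred I) (f : I -> T -> R)
    (l : I -> R) :
  (forall i, P i -> f i t @[t --> F] --> l i) ->
  (\sum_(i <- r | P i) f i t) @[t --> F] --> \sum_(i <- r | P i) l i.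
Proof. by move=> fl; apply: cvg_big => //; exact: add_continuous. Qed.

Lemma cvg_prodR (I : Type) (r : seq I) (P : pred I) (f : I -> T -> R)
    (l : I -> R) :
  (forall i, P i -> f i t @[t --> F] --> l i) ->
  (\prod_(i <- r | P i) f i t) @[t --> F] --> \prod_(i <- r | P i) l i.
Proof. by move=> fl; apply: cvg_big => //; exact: mul_continuous. Qed.

Lemma near_cvg_eq (f g : T -> R) (l : R) :
  (\forall t \near F, f t = g t) -> g t @[t --> F] --> l ->
  f t @[t --> F] --> l.
Proof. by move=> fg; apply: cvg_trans; apply: near_eq_cvg; apply: filterS fg => t ->. Qed.

Lemma cvg_natV (n : T -> nat) : n @ F --> \oo ->
  ((n t)%:R : R)^-1 @[t --> F] --> (0 : R).
Proof.
move=> /cvgnyPge ny; apply/cvgrPdist_le => e e0.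
near=> t; rewrite sub0r normrN normfV normr_nat.
have nt : (Num.truncn e^-1 < n t)%N by near: t; exact: ny.
rewrite invf_ple ?posrE ?ltr0n //; last exact: leq_ltn_trans nt.
apply: ltW; apply: lt_le_trans (truncnS_gt _) _.
by rewrite ler_nat.
Unshelve. all: by end_near. Qed.

Lemma near_gt0 (n : T -> nat) : n @ F --> \oo -> \forall t \near F, (0 < n t)%N.
Proof. by move=> /cvgnyPge /(_ 1%N). Qed.

(** Bounded errors do not change the limit of the ratio; this disposes of predecessors, shifts and
    truncated subtractions. *)
Lemma cvg_ratio_close (n M M' : T -> nat) (c : nat) (y : R) : n @ F --> \oo ->
  (\forall t \near F, (M t <= M' t + c)%N /\ (M' t <= M t + c)%N) ->
  (M t)%:R / (n t)%:R @[t --> F] --> y ->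
  (M' t)%:R / (n t)%:R @[t --> F] --> y.
Proof.
move=> ny cl My; have cn0 : c%:R * ((n t)%:R : R)^-1 @[t --> F] --> (0 : R).
  by rewrite -(mulr0 c%:R); apply: cvgM; [exact: cvg_cst|exact: cvg_natV].
apply: (@squeeze_cvgr _ _ _ _ (fun t => (M t)%:R / (n t)%:R - c%:R / (n t)%:R)
  (fun t => (M t)%:R / (n t)%:R + c%:R / (n t)%:R)).
- near=> t; rewrite -mulrBl -mulrDl; have nt : (0 < n t)%N by near: t; exact: near_gt0.
  rewrite !ler_pM2r ?invr_gt0 ?ltr0n // lerBlDr -!natrD !ler_nat.
  by apply/andP; near: t; exact: cl.
- by rewrite -[y]subr0; apply: cvgB.
- by rewrite -[y]addr0; apply: cvgD.
Unshelve. all: by end_near. Qed.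

Lemma cvg_binomial (n M : T -> nat) (b : nat) (y : R) : n @ F --> \oo ->
  (M t)%:R / (n t)%:R @[t --> F] --> y ->
  'C(M t, b)%:R / (n t)%:R ^+ b @[t --> F] --> y ^+ b / b`!%:R.
Proof.
move=> ny My.
have e t : 'C(M t, b)%:R / (n t)%:R ^+ b
    = (\prod_(i < b) ((M t - i)%:R / (n t)%:R)) / b`!%:R :> R.
  have -> : 'C(M t, b)%:R = (M t ^_ b)%:R / b`!%:R :> R.
    by rewrite -bin_ffact natrM mulfK // pnatr_eq0 -lt0n fact_gt0.
  rewrite ffact_prod natr_prod big_split /= prodr_const card_ord exprVn.
  by rewrite mulrAC.
rewrite (_ : (fun t => _) = fun t => (\prod_(i < b) ((M t - i)%:R / (n t)%:R)) / b`!%:R :> R); last first.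
  by apply/funext => t; rewrite e.
have -> : y ^+ b = \prod_(i < b) y by rewrite prodr_const card_ord.
apply: cvgM; last exact: cvg_cst.
apply: cvg_prodR => i _; apply: (@cvg_ratio_close n M _ i _ ny _ My).
by apply: nearW => t; split; lia.
Qed.

End limits.

Section asymptotics.
Context {R : realType} {T : Type} {F : set_system T} {FF : Filter F}.

(** Both bounds on k^(a+1) [comb_conv] are binomial coefficients C(n + O(1), a + b + 1), hence
    equivalent to n^(a+b+1) / (a+b+1)!. *)
Lemma cvg_comb_conv (n : T -> nat) (a b k : nat) : (0 < k)%N -> n @ F --> \oo ->
  (comb_conv a b k (n t).-1)%:R / (n t)%:R ^+ (a + b).+1 @[t --> F]
    --> ((k%:R ^+ a.+1 * ((a + b).+1)`!%:R)^-1 : R).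
Proof.
move=> k0 ny.
have nn : (n t)%:R / (n t)%:R @[t --> F] --> (1 : R).
  apply: near_cvg_eq (cvg_cst _); near=> t; rewrite divff // pnatr_eq0 -lt0n.
  by near: t; exact: near_gt0.
have h (M : T -> nat) c : (\forall t \near F, (n t <= M t + c)%N /\ (M t <= n t + c)%N) ->
    k%:R ^- a.+1 * ('C(M t, (a + b).+1)%:R / (n t)%:R ^+ (a + b).+1) @[t --> F]
      --> ((k%:R ^+ a.+1 * ((a + b).+1)`!%:R)^-1 : R).
  move=> hM; rewrite invfM -[X in _ * X]mul1r -[X in _ * (X * _)](expr1n _ (a + b).+1).
  apply: cvgM; first exact: cvg_cst.
  apply: cvg_binomial => //; exact: cvg_ratio_close hM nn.
apply: (@squeeze_cvgr _ _ _ _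
  (fun t => k%:R ^- a.+1 * ('C(((n t).-1 - k * a).+1, (a + b).+1)%:R / (n t)%:R ^+ (a + b).+1))
  (fun t => k%:R ^- a.+1 * ('C(((n t).-1 + k).+1, (a + b).+1)%:R / (n t)%:R ^+ (a + b).+1))).
- near=> t.
  have nt : (0 < n t)%N by near: t; exact: near_gt0.
  have nt2 : (k * a < n t)%N by near: t; move/cvgnyPge : ny; exact.
  rewrite !mulrA !ler_pM2r ?invr_gt0 ?exprn_gt0 ?ltr0n //.
  rewrite ler_pdivrMl ?ler_pdivlMl ?exprn_gt0 ?ltr0n //.
  rewrite -natrX -!natrM !ler_nat comb_conv_lb //= ?comb_conv_ub //; lia.
- apply: (h _ (k * a)%N); near=> t.
  have nt2 : (k * a < n t)%N by near: t; move/cvgnyPge : ny; exact.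
  by lia.
- apply: (h _ k); near=> t.
  have nt : (0 < n t)%N by near: t; exact: near_gt0.
  by lia.
Unshelve. all: by end_near. Qed.

End asymptotics.

(** Truncated subtraction, read in the reals, is a maximum with 0. The case y = 0 is the delicate
    one, since [f] may then stay negative. *)
Lemma cvg_max0 {R : realType} {T : Type} {F : set_system T} {FF : Filter F}
    (f : T -> R) (y : R) : 0 <= y -> f t @[t --> F] --> y ->
  Num.max 0 (f t) @[t --> F] --> y.
Proof.
move=> y0 /cvgrPdist_le fy; apply/cvgrPdist_le => e /fy; apply: filterS => t.
have [f0|f0] := leP 0 (f t); first by [].
apply: le_trans; rewrite subr0 ger0_norm // (le_trans _ (ler_norm _)) //.
by rewrite lerDl oppr_ge0 ltW.
Qed.

Section equivalents.
Context {R : realType}.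

Lemma equiv_cst (f : nat -> R) (c : R) : c != 0 -> f t @[t --> \oo] --> c ->
  f ~_\oo (fun=> c).
Proof.
move=> c0 fc; apply/eqaddoP => e e0.
have : \forall t \near \oo, `|c - f t| <= e * `|c|.
  by move/cvgrPdist_le : fc; apply; rewrite mulr_gt0 // normr_gt0.
by apply: filterS => t; rewrite distrC.
Qed.

Lemma equiv_near_eq (f g : nat -> R) : (\forall t \near \oo, f t = g t) -> f ~_\oo g.
Proof.
move=> fg; apply/eqaddoP => e e0; apply: filterS fg => t.
by rewrite !fctE => ->; rewrite subrr normr0 mulr_ge0 // ltW.
Qed.

Lemma equiv_ratio (n r : nat -> nat) (x : R) : n @ \oo --> \oo ->
  (fun t => (r t)%:R : R) ~_\oo (fun t => x * (n t)%:R) ->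
  (r t)%:R / (n t)%:R @[t --> \oo] --> x.
Proof.
move=> ny /eqaddoP h; apply/cvgrPdist_le => e e0.
have e'0 : 0 < e / (`|x| + 1) by rewrite divr_gt0 // ltr_wpDl.
apply: filterS2 (near_gt0 ny) (h _ e'0) => t nt; rewrite !fctE => ht.
have n0 : (n t)%:R != 0 :> R by rewrite pnatr_eq0 -lt0n.
rewrite -[x](mulfK n0) -mulrBl normrM normfV normr_nat ler_pdivrMr ?ltr0n //.
rewrite distrC (le_trans ht) // normrM normr_nat mulrA ler_wpM2r //.
by rewrite mulrAC ler_pdivrMr ?ltr_wpDl // ler_wpM2l ?(ltW e0) // lerDl.
Qed.

End equivalents.

Section tail.
Context {R : realType} (gamma zeta : R) (w : nat -> R).
Hypothesis cvg_v : forall k, gnedin_v gamma zeta n k.+1 * n`!%:R * n%:R ^+ k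
  @[n --> \oo] --> w k.+1.

(* Up to the factor counting compositions, the probability of k.+1 blocks. *)
Definition block_coef (n k : nat) : R :=
  gnedin_v gamma zeta n k.+1 * (n`!%:R / (k.+1)`!%:R).

(** For k + 1 blocks the power n^k balances the two factors: it is the order of the count [G] and
    the inverse order of v n!. *)
Lemma cvg_term {T : Type} {F : set_system T} {FF : Filter F}
    (n : T -> nat) (G : T -> R) (g : R) (k : nat) :
  n @ F --> \oo -> G t / (n t)%:R ^+ k @[t --> F] --> g ->
  block_coef (n t) k * G t @[t --> F] --> w k.+1 / (k.+1)`!%:R * g.
Proof.
move=> ny Gg; rewrite mulrAC.
have h := cvgM (cvgM (cvg_comp _ _ ny (@cvg_v k)) Gg) (cvg_cst ((k.+1)`!%:R^-1 : R)).
apply: near_cvg_eq (h _ _ _); near=> t => /=.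
have n0 : (n t)%:R ^+ k != 0 :> R.
  by rewrite expf_neq0 // pnatr_eq0 -lt0n; near: t; exact: near_gt0.
rewrite /block_coef /=; set X := (n t)%:R ^+ k in n0 *.
by rewrite [_ * X * _]mulrACA divff // mulr1 mulrA mulrAC.
Unshelve. all: by end_near. Qed.

(** For n, r > 0 this is the probability that the least block has size at least r, by
    [prob_min_block]; its limits are studied here without any random partition. *)
Definition min_tail (n r : nat) : R :=
  \sum_(0 <= k < n) block_coef n k * ((k.+1 * r <= n)%N%:R * 'C(n.-1 - k.+1 * r.-1, k)%:R).

Section tail_limit.
Context {T : Type} {F : set_system T} {FF : ProperFilter F}.
Variables (n r : T -> nat) (x : R).
Hypothesis x0 : 0 < x.
Hypotheses (ny : n @ F --> \oo) (rn : (r t)%:R / (n t)%:R @[t --> F] --> x).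

Let K := Num.truncn x^-1.

Lemma near_mul_lt (c : nat) : c%:R * x < 1 -> \forall t \near F, (c * r t < n t)%N.
Proof.
move=> cx; have h : c%:R * ((r t)%:R / (n t)%:R) @[t --> F] --> c%:R * x.
  by apply: cvgM => //; exact: cvg_cst.
apply: filterS2 (cvgr_lt _ h _ cx) (near_gt0 ny) => t + nt.
by rewrite mulrA ltr_pdivrMr ?ltr0n // mul1r -natrM ltr_nat.
Qed.

Lemma near_mul_gt (c : nat) : 1 < c%:R * x -> \forall t \near F, (n t < c * r t)%N.
Proof.
move=> cx; have h : c%:R * ((r t)%:R / (n t)%:R) @[t --> F] --> c%:R * x.
  by apply: cvgM => //; exact: cvg_cst.
apply: filterS2 (cvgr_gt _ h _ cx) (near_gt0 ny) => t + nt.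
by rewrite mulrA ltr_pdivlMr ?ltr0n // mul1r -natrM ltr_nat.
Qed.

(** Since (K + 1) x > 1, eventually (K + 1) r > n, and this single inequality makes every indicator
    with k >= K vanish. *)
Lemma near_min_tail : \forall t \near F, min_tail (n t) (r t)
  = \sum_(0 <= k < K) block_coef (n t) k *
      ((k.+1 * r t <= n t)%N%:R * 'C((n t).-1 - k.+1 * (r t).-1, k)%:R).
Proof.
have KS : 1 < K.+1%:R * x.
  by rewrite -ltr_pdivrMr // mul1r truncnS_gt.
have nK : \forall t \near F, (K <= n t)%N by move/cvgnyPge : ny; exact.
apply: filterS2 (near_mul_gt KS) nK => t Kt nt.
rewrite /min_tail (big_cat_nat (n := K)) //= [X in _ + X]big1_seq ?addr0 //.
move=> k /andP[_]; rewrite mem_index_iota => /andP[Kk _].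
suff -> : (k.+1 * r t <= n t)%N = false by rewrite mul0r mulr0.
by apply/negbTE; rewrite -ltnNge (leq_trans Kt) // leq_mul2r ltnS Kk orbT.
Qed.

Hypothesis x1 : x = 1 -> \forall t \near F, (r t <= n t)%N.

Lemma cvg_min_count (k : nat) : k.+1%:R * x <= 1 ->
  ((k.+1 * r t <= n t)%N%:R * 'C((n t).-1 - k.+1 * (r t).-1, k)%:R) / (n t)%:R ^+ k
    @[t --> F] --> (1 - k.+1%:R * x) ^+ k / k`!%:R.
Proof.
move=> kx.
have M : ((n t).-1 - k.+1 * (r t).-1)%N%:R / (n t)%:R @[t --> F] --> 1 - k.+1%:R * x.
  apply: (@cvg_ratio_close _ _ _ _ n (fun t => n t - k.+1 * r t)%N _ k.+2) => //.
    by apply: nearW => t; split; nia.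
  have h : 1 - k.+1%:R * ((r t)%:R / (n t)%:R) @[t --> F] --> 1 - k.+1%:R * x.
    by apply: cvgB; [exact: cvg_cst|apply: cvgM => //; exact: cvg_cst].
  have hm : Num.max 0 (1 - k.+1%:R * ((r t)%:R / (n t)%:R)) @[t --> F] --> 1 - k.+1%:R * x.
    by apply: cvg_max0; rewrite ?subr_ge0.
  apply: near_cvg_eq hm; apply: filterS (near_gt0 ny) => t nt.
  have n0 : 0 < (n t)%:R :> R by rewrite ltr0n.
  rewrite mulrA -[X in Num.max _ (X - _)](divff (lt0r_neq0 n0)) -mulrBl -natrM.
  have [h1|h1] := leqP (k.+1 * r t) (n t).
    by rewrite natrB // max_r // divr_ge0 ?(ltW n0) // subr_ge0 ler_nat.
  rewrite (_ : _ - _ = 0)%N ?mul0r; last by apply/eqP; rewrite subn_eq0 ltnW.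
  by rewrite max_l // pmulr_lle0 ?invr_gt0 // subr_le0 ler_nat ltnW.
have C : 'C((n t).-1 - k.+1 * (r t).-1, k)%:R / (n t)%:R ^+ k @[t --> F] -->
  (1 - k.+1%:R * x) ^+ k / k`!%:R by exact: cvg_binomial.
(* Below the threshold the indicator is eventually 1. At the threshold it may oscillate: if k > 0
   the binomial part tends to 0 and squeezes the product; if k = 0 then x = 1 and [x1] fixes the
   indicator. *)
have [kx1|kx1] := ltP (k.+1%:R * x) 1.
  apply: near_cvg_eq C; apply: filterS (near_mul_lt kx1) => t /ltnW ->.
  by rewrite mul1r.
have {kx kx1} kx : k.+1%:R * x = 1 by apply/le_anti; rewrite kx.
case: k kx M C => [|k] kx M C.
  have xe : x = 1 by rewrite -kx mul1r.
  apply: near_cvg_eq C; apply: filterS (x1 xe) => t; rewrite mul1n => ->.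
  by rewrite mul1r.
rewrite kx subrr expr0n /= mul0r in C *.
apply: (@squeeze_cvgr _ _ _ _ (fun=> 0) _ _ _ _ (cvg_cst _) C).
apply: nearW => t; rewrite -mulrA; case: (_ <= _)%N; rewrite ?mul1r ?mul0r.
  by rewrite lexx divr_ge0 // exprn_ge0.
by rewrite lexx /= divr_ge0 // exprn_ge0.
Qed.

Lemma cvg_min_tail : min_tail (n t) (r t) @[t --> F] -->
  \sum_(1 <= m < K.+1)
     w m / (m`!%:R * (m - 1)`!%:R) * (1 - m%:R * x) ^+ (m - 1).
Proof.
apply: (near_cvg_eq near_min_tail).
rewrite big_add1 /= !big_mkord; under eq_cvg do rewrite big_mkord.
apply: cvg_sumR => k _; rewrite subn1 /=.
have kx : k.+1%:R * x <= 1.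
  rewrite -ler_pdivlMr // mul1r; apply: (@le_trans _ _ K%:R); first by rewrite ler_nat.
  by rewrite truncn_le invr_ge0 ltW.
rewrite invfM mulrA -[X in _ --> X]mulrA [_^-1 * _]mulrC.
by apply: cvg_term => //; exact: cvg_min_count.
Qed.

End tail_limit.
End tail.

(** * ** Dominated summation over the number of blocks *)

Section tannery.
Context {R : realType} (f p : nat -> nat -> R) (g : nat -> R) (D : R).
Hypothesis f0 : forall n k, (k < n)%N -> 0 <= f n k.
Hypothesis p0 : forall n k, (k < n)%N -> 0 <= p n k.
Hypothesis fp : forall n k, (k < n)%N -> f n k <= D * p n k / k.+1%:R.
Hypothesis p1 : forall n, (0 < n)%N -> \sum_(0 <= k < n) p n k = 1.
Hypothesis D0 : 0 <= D.
Hypothesis fg : forall k, f n k @[n --> \oo] --> g k.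

(** The weights [p n] have sum 1, so the factor 1 / (k + 1) alone makes the tails from K on smaller
    than D / (K + 1), uniformly in n. *)
Let sum_f_tail (n K L : nat) : (K <= L <= n)%N -> (0 < n)%N ->
  0 <= \sum_(K <= k < L) f n k <= D / K.+1%:R.
Proof.
move=> /andP[KL Ln] n0.
have kn k : (K <= k < L)%N -> (k < n)%N by move=> /andP[_ /leq_trans]; apply.
rewrite big_nat sumr_ge0 /=; last by move=> k /kn; exact: f0.
apply: (@le_trans _ _ (\sum_(K <= k < L) D / K.+1%:R * p n k)).
  rewrite [leRHS]big_nat; apply: ler_sum => k kKL.
  apply: le_trans (fp (kn _ kKL)) _; rewrite mulrAC ler_wpM2r ?p0 ?kn //.
  rewrite ler_wpM2l // lef_pV2 ?posrE ?ltr0n // ler_nat ltnS.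
  by case/andP: kKL.
rewrite -mulr_sumr ler_piMr ?divr_ge0 //.
rewrite -(p1 n0) [leRHS](big_cat_nat (n := K)) //= ?(leq_trans KL) //.
rewrite (@big_cat_nat _ _ _ L K n) //= addrCA lerDl addr_ge0 // big_nat sumr_ge0 //.
  by move=> k /andP[_ kK]; rewrite p0 // (leq_trans kK) // (leq_trans KL).
by move=> k /andP[_ kK]; rewrite p0.
Qed.

Let sum_g_tail (K L : nat) : (K <= L)%N ->
  0 <= \sum_(K <= k < L) g k <= D / K.+1%:R.
Proof.
move=> KL.
have h : \sum_(K <= k < L) f n k @[n --> \oo] --> \sum_(K <= k < L) g k.
  by apply: cvg_sumR => k _; exact: fg.
have nL : \forall n \near \oo, 0 <= \sum_(K <= k < L) f n k <= D / K.+1%:R.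
  by exists L.+1 => // n /= Ln; apply: sum_f_tail; [rewrite KL ltnW|exact: leq_trans Ln].
have e := cvg_lim (@Rhausdorff R) h.
apply/andP; split; rewrite -e.
  by apply: limr_ge; [apply/cvg_ex; eexists; exact: h|apply: filterS nL => n /andP[]].
by apply: limr_le; [apply/cvg_ex; eexists; exact: h|apply: filterS nL => n /andP[]].
Qed.

Lemma tannery_is_cvg : cvgn (fun N => \sum_(0 <= k < N) g k).
Proof.
apply: nondecreasing_is_cvgn.
  move=> m n mn; rewrite [leRHS](big_cat_nat (n := m)) //= lerDl.
  by case/andP: (sum_g_tail mn).
exists D => _ [N _ <-]; have /andP[_] := sum_g_tail (leq0n N).
by rewrite divr1.
Qed.

Lemma tannery : \sum_(0 <= k < n) f n k @[n --> \oo] -->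
  limn (fun N => \sum_(0 <= k < N) g k).
Proof.
set l := limn _; apply/cvgrPdist_le => e e0.
have [K DK] : exists K : nat, D / K.+1%:R <= e / 3.
  exists (Num.truncn (D / (e / 3))); rewrite ler_pdivrMr ?ltr0n //.
  by rewrite mulrC -ler_pdivrMr ?divr_gt0 // ltW // truncnS_gt.
have hK : \sum_(0 <= k < K) f n k @[n --> \oo] --> \sum_(0 <= k < K) g k.
  by apply: cvg_sumR => k _; exact: fg.
have lK : `|l - \sum_(0 <= k < K) g k| <= e / 3.
  have Nl : \forall N \near \oo, \sum_(0 <= k < K) g k <= \sum_(0 <= k < N) g k
      <= \sum_(0 <= k < K) g k + e / 3.
    exists K => // N /= KN; rewrite [X in _ <= X <= _](big_cat_nat (n := K)) //= lerDl lerD2l.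
    by case/andP: (sum_g_tail KN) => -> /le_trans ->.
  have h1 : \sum_(0 <= k < K) g k <= l.
    by apply: limr_ge; [exact: tannery_is_cvg|apply: filterS Nl => N /andP[]].
  have h2 : l <= \sum_(0 <= k < K) g k + e / 3.
    by apply: limr_le; [exact: tannery_is_cvg|apply: filterS Nl => N /andP[]].
  by rewrite ger0_norm ?subr_ge0 // lerBlDl.
have e3 : 0 < e / 3 by rewrite divr_gt0.
near=> n.
have Kn : (K < n)%N by near: n; exists K.+1.
rewrite (big_cat_nat (n := K)) //= ?(ltnW Kn) // opprD addrA.
have -> : e = e / 3 + e / 3 + e / 3 by field.
apply: le_trans (ler_normB _ _) _; apply: lerD; last first.
  have /andP[s0 s1] : 0 <= \sum_(K <= k < n) f n k <= D / K.+1%:R.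
    by apply: sum_f_tail; [rewrite leqnn ltnW|exact: leq_trans Kn].
  by rewrite ger0_norm // (le_trans s1).
rewrite -[l](subrK (\sum_(0 <= k < K) g k)) -addrA.
apply: le_trans (ler_normD _ _) _; apply: lerD => //.
by near: n; move/cvgrPdist_le : hK => /(_ _ e3).
Unshelve. all: by end_near. Qed.

End tannery.

(* This makes the contribution of k.+1 blocks to the moment O(P(k.+1 blocks) / k.+1)
   uniformly in n, so that dominated summation needs no tightness. *)
Lemma comb_conv_moment (a k n : nat) : (k < n)%N ->
  (a.+1`! * comb_conv a k k.+1 n.-1 * k.+1 ^ a.+1 <= (2 * n) ^ a.+1 * 'C(n.-1, k))%N.
Proof.
move=> kn; set q := (n.-1 %/ k.+1).+1.
(* Bounding the second binomial by C(n - 1, k) leaves the hockey-stick sum C(q, a + 1) <= q^(a+1) /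
   (a+1)!, and q (k + 1) <= n + k <= 2 n is the origin of the factor 2. *)
have h : (comb_conv a k k.+1 n.-1 <= 'C(q, a.+1) * 'C(n.-1, k))%N.
  have := sum_bin_upper a 0 q.-1; rewrite addn0 prednK // => <-.
  rewrite big_distrl /=; apply: leq_sum => s _.
  by rewrite bin0 muln1 leq_mul2l leq_bin2l ?orbT // leq_subr.
have h2 : (a.+1`! * 'C(q, a.+1) <= q ^ a.+1)%N.
  rewrite mulnC bin_ffact.
  elim: a.+1 => // b IH; rewrite ffactnSr expnS [leqRHS]mulnC leq_mul //.
  exact: leq_subr.
apply: (@leq_trans (q ^ a.+1 * 'C(n.-1, k) * k.+1 ^ a.+1)%N).
  rewrite leq_mul2r; apply/orP; right.
  apply: (@leq_trans (a.+1`! * ('C(q, a.+1) * 'C(n.-1, k)))%N).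
    by rewrite leq_mul2l h orbT.
  by rewrite mulnA leq_mul2r h2 orbT.
rewrite mulnAC leq_mul2r -expnMn leq_exp2r //; apply/orP; right.
by rewrite /q mulSn; have := leq_trunc_div n.-1 k.+1; lia.
Qed.

Section moment.
Context {R : realType} (gamma zeta : R) (w : nat -> R).
Hypothesis cvg_v : forall k, gnedin_v gamma zeta n k.+1 * n`!%:R * n%:R ^+ k
  @[n --> \oo] --> w k.+1.
Hypothesis v0 : forall n k, (k < n)%N -> 0 <= gnedin_v gamma zeta n k.+1.
Hypothesis v1 : forall n, (0 < n)%N ->
  \sum_(0 <= k < n) block_coef gamma zeta n k * 'C(n.-1, k)%:R = 1.

Let u (j m : nat) : R := w m / (m`!%:R * (m + j - 1)`!%:R * m%:R ^+ j).

Let f (a n k : nat) : R :=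
  block_coef gamma zeta n k * ((a.+1`! * comb_conv a k k.+1 n.-1)%:R / n%:R ^+ a.+1).

Let term_ge0 (n k : nat) : (k < n)%N -> 0 <= block_coef gamma zeta n k.
Proof. by move=> kn; rewrite /block_coef mulr_ge0 ?v0 // divr_ge0. Qed.

Let f_ge0 (a n k : nat) : (k < n)%N -> 0 <= f a n k.
Proof. by move=> kn; rewrite /f mulr_ge0 ?term_ge0 // divr_ge0 // exprn_ge0. Qed.

(** This is the domination for [tannery], with D = 2^(a+1) and p the probability of k + 1 blocks;
    one of the a + 1 available powers of 1 / (k + 1) is kept. *)
Let f_le (a n k : nat) : (k < n)%N ->
  f a n k <= 2 ^+ a.+1 * (block_coef gamma zeta n k * 'C(n.-1, k)%:R) / k.+1%:R.
Proof.
move=> kn; rewrite /f [2 ^+ _ * _]mulrCA -[leRHS]mulrA ler_wpM2l ?term_ge0 //.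
have n0 : 0 < n%:R :> R by rewrite ltr0n (leq_trans _ kn).
rewrite ler_pdivrMr ?exprn_gt0 // mulrAC ler_pdivlMr ?ltr0n //.
rewrite [leRHS]mulrAC -exprMn -(natrM _ 2 n) -natrX -!natrM ler_nat.
apply: leq_trans (comb_conv_moment a kn); rewrite leq_mul2l.
by apply/orP; right; rewrite -[leqLHS]expn1 leq_pexp2l.
Qed.

Let f_cvg (a k : nat) : f a n k @[n --> \oo] --> (a.+1)`!%:R * u a.+1 k.+1.
Proof.
have idy : (fun n : nat => n) @ \oo --> \oo by exact: cvg_id.
have -> : (a.+1)`!%:R * u a.+1 k.+1 = w k.+1 / (k.+1)`!%:R *
    ((a.+1)`!%:R * (k.+1%:R ^+ a.+1 * ((a + k).+1)`!%:R)^-1).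
  rewrite /u addSn addnS subn1 /= [(k + a)%N]addnC.
  by rewrite !invfM; ring.
apply: (cvg_term (w := w) cvg_v (n := fun n => n)) => //.
have h : (a.+1)`!%:R * ((comb_conv a k k.+1 n.-1)%:R / n%:R ^+ (a + k).+1) @[n --> \oo]
    --> (a.+1)`!%:R * ((k.+1%:R ^+ a.+1 * ((a + k).+1)`!%:R)^-1 : R).
  by apply: cvgM; [exact: cvg_cst|exact: cvg_comb_conv].
apply: near_cvg_eq h; apply: nearW => n.
by rewrite -addSn exprD natrM invfM !mulrA.
Qed.

Lemma moment_is_cvg (j : nat) : (0 < j)%N ->
  cvgn (fun N => \sum_(1 <= m < N) u j m).
Proof.
case: j => // a _.
have /cvg_ex[l h] := tannery_is_cvg (@f_ge0 a) (fun n k kn => mulr_ge0 (term_ge0 kn) (ler0n _ _))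
  (@f_le a) v1 (exprn_ge0 _ (ler0n _ 2)) (@f_cvg a).
apply/cvg_ex; exists ((a.+1)`!%:R^-1 * l); rewrite -cvg_shiftS.
have {}h : (a.+1)`!%:R^-1 * \sum_(0 <= k < n) ((a.+1)`!%:R * u a.+1 k.+1) @[n --> \oo] -->
  (a.+1)`!%:R^-1 * l by apply: cvgM => //; exact: cvg_cst.
apply: near_cvg_eq h; apply: nearW => n /=.
by rewrite big_add1 -mulr_sumr mulKf // pnatr_eq0 -lt0n fact_gt0.
Qed.

Lemma cvg_moment (j : nat) : (0 < j)%N ->
  \sum_(0 <= k < n) block_coef gamma zeta n k * ((j`! * comb_conv j.-1 k k.+1 n.-1)%:R / n%:R ^+ j)
    @[n --> \oo] --> j`!%:R * limn (fun N => \sum_(1 <= m < N) u j m).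
Proof.
move=> j0; have := moment_is_cvg j0; case: j j0 => // a _ cu.
have := tannery (@f_ge0 a) (fun n k kn => mulr_ge0 (term_ge0 kn) (ler0n _ _))
  (@f_le a) v1 (exprn_ge0 _ (ler0n _ 2)) (@f_cvg a).
suff -> : limn (fun N => \sum_(0 <= k < N) ((a.+1)`!%:R * u a.+1 k.+1)) =
  (a.+1)`!%:R * limn (fun N => \sum_(1 <= m < N) u a.+1 m) by [].
apply: cvg_lim => //.
have h : (a.+1)`!%:R * \sum_(1 <= m < n.+1) u a.+1 m @[n --> \oo] -->
   (a.+1)`!%:R * limn (fun N => \sum_(1 <= m < N) u a.+1 m).
  by apply: cvgM; [exact: cvg_cst|move: (cu : _ --> _); rewrite -cvg_shiftS].
apply: near_cvg_eq h; apply: nearW => n /=.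
by rewrite big_add1 -mulr_sumr.
Qed.

End moment.

(** * The random partition *)

Lemma card_set_partition (n : nat) (pi : {set {set 'I_n}}) : (0 < n)%N ->
  set_partition pi -> (0 < #|pi| <= n)%N.
Proof.
move=> n0 pip; have c := card_partition pip; rewrite cardsT card_ord in c.
apply/andP; split.
  by rewrite lt0n; apply: contraTneq n0 => /cards0_eq p0; rewrite c p0 big_set0.
rewrite [X in (_ <= X)%N]c -sum1_card; apply: leq_sum => B Bpi.
by rewrite card_gt0 (partition_neq0 pip).
Qed.

Lemma sum_set_partition (R : realType) (n : nat) (Q : pred {set {set 'I_n}})
    (F : {set {set 'I_n}} -> R) : (0 < n)%N ->
  \sum_(pi : {set {set 'I_n}} | set_partition pi && Q pi) F pi
  = \sum_(0 <= k < n) \sum_(pi : {set {set 'I_n}} |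
       set_partition pi && (#|pi| == k.+1) && Q pi) F pi.
Proof.
move=> n0; rewrite big_mkord.
case: n n0 Q F => // n _ Q F.
rewrite (partition_big (fun pi : {set {set 'I_n.+1}} => inord #|pi|.-1 : 'I_n.+1) xpredT) //=.
apply: eq_bigr => k _; apply: eq_bigl => pi.
have [pip|//] := boolP (set_partition pi); rewrite /= andbC; congr (_ && _).
have /andP[p0 pn] := card_set_partition (ltn0Sn n) pip.
by rewrite -val_eqE /= inordK ?prednK // -[in RHS](prednK p0) eqSS.
Qed.

(** Hockey-stick identity in layer-cake form: it expresses factorial moments through the tail
    probabilities of the least block. *)
Lemma ffactn_sum (n m j : nat) : (m <= n)%N ->
  (m ^_ j.+1 = j.+1`! * \sum_(0 <= s < n) 'C(s, j) * (s < m))%N.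
Proof.
move=> mn; rewrite -bin_ffact mulnC; congr (_ * _)%N.
rewrite (big_cat_nat (n := m)) //= [X in (_ + X)%N]big1_seq ?addn0; last first.
  move=> s /andP[_]; rewrite mem_index_iota => /andP[ms _].
  by rewrite ltnNge ms muln0.
case: m mn => [|m] mn; first by rewrite big_geq // bin0n.
have := sum_bin_upper j 0 m; rewrite addn0 => <-.
by apply: eq_big_nat => s /andP[_ sm]; rewrite sm bin0.
Qed.

(** Taking r = s + 1 in the count of compositions. Within the range of [comb_conv], a false
    indicator forces n - 1 - (k + 1) s < k, so the last binomial is already 0. *)
Lemma comb_convE (a k n : nat) : (0 < n)%N ->
  (\sum_(0 <= s < n) 'C(s, a) * ((k.+1 * s.+1 <= n) * 'C(n.-1 - k.+1 * s, k))
   = comb_conv a k k.+1 n.-1)%N.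
Proof.
move=> n0; rewrite /comb_conv.
have qn : ((n.-1 %/ k.+1).+1 <= n)%N.
  by rewrite -[leqRHS](prednK n0) ltnS leq_div.
rewrite (big_cat_nat (n := (n.-1 %/ k.+1).+1)) //= [X in (_ + X)%N]big1_seq ?addn0; last first.
  move=> s /andP[_]; rewrite mem_index_iota => /andP[qs _].
  suff -> : (k.+1 * s.+1 <= n)%N = false by rewrite mul0n muln0.
  apply/negbTE; rewrite -ltnNge.
  by move: qs; rewrite ltn_divLR // mulnC mulnS; lia.
apply: eq_big_nat => s /andP[_ sq]; congr (_ * _)%N.
have [h|h] := leqP (k.+1 * s.+1) n; first by rewrite mul1n.
rewrite bin_small //; move: sq h; rewrite ltnS leq_divRL // mulnC.
by move=> ? ?; lia.
Qed.

Section probability.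
Context {R : realType} (d : measure_display) (T : measurableType d)
  (P : probability T R) (gamma zeta : R)
  (Pi : forall n : nat, T -> {set {set 'I_n}}).
Hypothesis HPi : gnedin_partition P gamma zeta Pi.

Let mPi (n : nat) (pi : {set {set 'I_n}}) : measurable [set t | Pi n t = pi].
Proof. by case: HPi. Qed.

Let partPi (n : nat) (t : T) : set_partition (Pi n t).
Proof. by case: HPi. Qed.

Let probPi (n : nat) (pi : {set {set 'I_n}}) : (0 < n)%N -> set_partition pi ->
  P [set t | Pi n t = pi] = (gnedin_prob gamma zeta pi)%:E.
Proof. by case: HPi => _ _ _; apply. Qed.

Lemma measurable_partition (n : nat) (Q : pred {set {set 'I_n}}) :
  measurable [set t | Q (Pi n t)].
Proof.
have -> : [set t | Q (Pi n t)] = \bigcup_(pi in [set pi | Q pi]) [set t | Pi n t = pi].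
  apply/seteqP; split => [t Qt|t [pi /= Qpi e]] /=; [by exists (Pi n t)|by rewrite e].
by apply: fin_bigcup_measurable => //; exact: finite_finset.
Qed.

Lemma expectation_partition (n : nat) (g : {set {set 'I_n}} -> R) :
  (0 < n)%N -> (forall pi, 0 <= g pi) ->
  'E_P[(fun t => g (Pi n t))%R]%E
  = (\sum_(pi : {set {set 'I_n}} | set_partition pi) g pi * gnedin_prob gamma zeta pi)%:E.
Proof.
move=> n0 g0; rewrite unlock.
transitivity (\int[P]_t \sum_(pi <- index_enum {set {set 'I_n}})
    ((g pi)%:E * (\1_([set t | Pi n t = pi]) t)%:E))%E.
  apply: eq_integral => t _; rewrite (bigD1 (Pi n t)) //= big1 ?adde0.
    by rewrite indicE mem_set // mule1.
  by move=> pi pit; rewrite indicE memNset ?mule0 //= => /esym/eqP; exact/negP.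
rewrite ge0_integral_sum //=; last 2 first.
- by move=> pi; apply: measurable_funeM; apply/measurable_EFinP; exact: measurable_indic.
- by move=> pi t _; rewrite -EFinM lee_fin mulr_ge0.
rewrite -sumEFin [RHS]big_mkcond; apply: eq_bigr => pi _.
rewrite ge0_integralZl_EFin //; last first.
  by apply/measurable_EFinP; exact: measurable_indic.
rewrite integral_indic // setIT.
case: ifPn => [pip|npip]; first by rewrite EFinM -(probPi n0 pip).
rewrite (_ : [set _ | _] = set0) ?measure0 ?mule0 //.
by rewrite -subset0 => t /= e; move: npip; rewrite -e partPi.
Qed.

Lemma prob_partition (n : nat) (Q : pred {set {set 'I_n}}) : (0 < n)%N ->
  P [set t | Q (Pi n t)]
  = (\sum_(pi : {set {set 'I_n}} | set_partition pi && Q pi) gnedin_prob gamma zeta pi)%:E.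
Proof.
move=> n0; rewrite -expectation_indic; last exact: measurable_partition.
rewrite (_ : \1__ = fun t => (Q (Pi n t))%:R); last first.
  apply/funext => t; rewrite indicE; have [q|q] := boolP (Q (Pi n t)).
    by rewrite mem_set.
  by rewrite memNset //=; exact/negP.
rewrite (@expectation_partition n (fun pi => (Q pi)%:R)) //.
congr EFin; rewrite [RHS]big_mkcondr; apply: eq_bigr => pi _.
by case: (Q pi); rewrite ?mul1r ?mul0r.
Qed.

Lemma prob_min_block (n r : nat) : (0 < n)%N -> (0 < r)%N ->
  P [set t | (r <= min_block (Pi n t))%N] = (min_tail gamma zeta n r)%:E.
Proof.
move=> n0 r0; rewrite (prob_partition (fun pi => r <= min_block pi)%N n0).
rewrite sum_set_partition //; congr EFin; apply: eq_bigr => k _.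
by rewrite gnedin_prob_sum.
Qed.

(** For r = 1 every partition qualifies, so the summands are the probabilities of k + 1 blocks; the
    normalisation of the v_{n,k} is read off from P being a probability. *)
Lemma sum_term (n : nat) : (0 < n)%N ->
  \sum_(0 <= k < n) block_coef gamma zeta n k * 'C(n.-1, k)%:R = 1.
Proof.
move=> n0; apply: EFin_inj; rewrite -(@probability_setT _ _ _ P).
rewrite (_ : [set: T] = [set t | xpredT (Pi n t)]); last by apply/seteqP; split.
rewrite (prob_partition xpredT n0) sum_set_partition //; congr EFin.
apply: eq_big_nat => k /andP[_ kn].
transitivity (block_coef gamma zeta n k * ((k.+1 * 1 <= n)%N%:R * 'C(n.-1 - k.+1 * 1.-1, k)%:R)).
  by rewrite muln1 kn mul1r muln0 subn0.
rewrite -gnedin_prob_sum //; apply: eq_bigl => pi.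
have [pip|//] := boolP (set_partition pi); rewrite leq_min_block //.
case: (_ == _) => //=; apply/forall_inP => B Bpi.
by rewrite card_gt0 (partition_neq0 pip).
Qed.

Lemma prob_card_le (n m : nat) : (0 < n)%N -> (m <= n)%N ->
  P [set t | (#|Pi n t| <= m)%N]
  = (\sum_(0 <= k < m) block_coef gamma zeta n k * 'C(n.-1, k)%:R)%:E.
Proof.
move=> n0 mn; rewrite (prob_partition (fun pi => #|pi| <= m)%N n0).
rewrite sum_set_partition //; congr EFin.
rewrite (big_cat_nat (n := m)) //= [X in _ + X]big1_seq ?addr0; last first.
  move=> k /andP[_]; rewrite mem_index_iota => /andP[mk _].
  by rewrite big_pred0 // => pi; case: eqP => [->|]; rewrite ?andbF // ltnNge mk andbF.
apply: eq_big_nat => k /andP[_ km].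
have kn := leq_trans km mn.
transitivity (block_coef gamma zeta n k * ((k.+1 * 1 <= n)%N%:R * 'C(n.-1 - k.+1 * 1.-1, k)%:R)); last first.
  by rewrite muln1 kn mul1r muln0 subn0.
rewrite -gnedin_prob_sum //; apply: eq_bigl => pi.
have [pip|//] := boolP (set_partition pi); rewrite leq_min_block //.
case: eqP => [->|//] /=; rewrite km; apply/esym/forall_inP => B Bpi.
by rewrite card_gt0 (partition_neq0 pip).
Qed.

(** With j = a + 1, E [min]_j = j! sum_s C(s, a) P(min > s); exchanging this sum with the one over
    the number of blocks leaves [comb_conv] inside. *)
Lemma moment_min_block (n j : nat) : (0 < n)%N -> (0 < j)%N ->
  'E_P[(fun t => (min_block (Pi n t) ^_ j)%:R / n%:R ^+ j)%R]%E
  = (\sum_(0 <= k < n) block_coef gamma zeta n k *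
      ((j`! * comb_conv j.-1 k k.+1 n.-1)%:R / n%:R ^+ j))%:E.
Proof.
case: j => // a n0 _.
rewrite (@expectation_partition n (fun pi => (min_block pi ^_ a.+1)%:R / n%:R ^+ a.+1)) //.
congr EFin; rewrite /=.
transitivity (\sum_(0 <= s < n) (a.+1)`!%:R / n%:R ^+ a.+1 * 'C(s, a)%:R * min_tail gamma zeta n s.+1).
  have e s : min_tail gamma zeta n s.+1 =
      \sum_(pi : {set {set 'I_n}} | set_partition pi) (s < min_block pi)%N%:R * gnedin_prob gamma zeta pi.
    apply: EFin_inj; rewrite -prob_min_block //.
    rewrite (prob_partition (fun pi => s < min_block pi)%N n0); congr EFin.
    by rewrite [LHS]big_mkcondr; apply: eq_bigr => pi _; case: (_ < _)%N; rewrite ?mul1r ?mul0r.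
  under [RHS]eq_bigr => s _ do rewrite e mulr_sumr.
  rewrite exchange_big /=; apply: eq_bigr => pi _.
  rewrite (ffactn_sum a (min_block_leq pi)) natrM natr_sum mulrAC mulr_sumr mulr_suml.
  by rewrite mulr_suml; apply: eq_bigr => s _; rewrite natrM; ring.
under [LHS]eq_bigr => s _ do rewrite /min_tail mulr_sumr.
rewrite exchange_big /=; apply: eq_bigr => k _.
rewrite -comb_convE // [in RHS]natrM natr_sum [X in _ = _ * X]mulrAC [X in _ = _ * X]mulr_sumr mulr_sumr.
by apply: eq_bigr => s _; rewrite !natrM; ring.
Qed.

Lemma card_Pi_homo (t : T) : {homo (fun n => #|Pi n t|) : m n / (m <= n)%N}.
Proof.
apply: homo_leq => [//|? ? ?|n]; first exact: leq_trans.
case: HPi => _ /(_ n t) -> _ _; rewrite /restrict_partition.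
apply: leq_trans (leq_imset_card (fun B : {set 'I_n.+1} => widen_ord (leqnSn n) @^-1: B)%SET _).
by apply: subset_leq_card; exact: subsetDl.
Qed.

Let K (t : T) : \bar R := nblocks_lim R Pi t.

Let card_homo (t : T) :
  {homo (fun n => (#|Pi n t|%:R : R)%:E) : m n / (m <= n)%N >-> (m <= n)%E}.
Proof. by move=> m n mn; rewrite lee_fin ler_nat card_Pi_homo. Qed.

Lemma nblocks_is_cvg (t : T) : cvgn (fun n => (#|Pi n t|%:R : R)%:E).
Proof. by apply: ereal_nondecreasing_is_cvgn; exact: card_homo. Qed.

Lemma nblocks_lim_le (t : T) (m : nat) :
  (K t <= m%:R%:E)%E <-> forall n, (#|Pi n t| <= m)%N.
Proof.
have e : K t = ereal_sup (range (fun n => (#|Pi n t|%:R : R)%:E)).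
  by apply: cvg_lim => //; apply: ereal_nondecreasing_cvgn; exact: card_homo.
rewrite e; split => [h n|h].
  rewrite -(ler_nat R) -lee_fin (le_trans _ h) //.
  by apply: ereal_sup_ubound; exists n.
by apply: ge_ereal_sup => _ [n _ <-]; rewrite lee_fin ler_nat.
Qed.

Lemma nblocks_lim_eq (t : T) (m : nat) :
  K t = m.+1%:R%:E <->
  (forall n, (#|Pi n t| <= m.+1)%N) /\ ~ (forall n, (#|Pi n t| <= m)%N).
Proof.
split => [e|[h1 h2]].
  split; first by apply/nblocks_lim_le; rewrite e.
  by move=> /nblocks_lim_le; rewrite e lee_fin ler_nat ltnn.
apply/le_anti/andP; split; first exact/nblocks_lim_le.
have [n hn] : exists n, (m < #|Pi n t|)%N.
  by move/existsNP : h2 => [n /negP]; rewrite -ltnNge; exists n.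
apply: (@le_trans _ _ (#|Pi n t|%:R%:E)); first by rewrite lee_fin ler_nat.
rewrite /K /nblocks_lim.
have -> : limn (fun n => (#|Pi n t|%:R : R)%:E) = ereal_sup (range (fun n => (#|Pi n t|%:R : R)%:E)).
  by apply: cvg_lim => //; apply: ereal_nondecreasing_cvgn; exact: card_homo.
by apply: ereal_sup_ubound; exists n.
Qed.

End probability.

(** * ** The limit law of the number of blocks *)

Section nblocks_limit.
Context {R : realType} (d : measure_display) (T : measurableType d)
  (P : probability T R) (gamma zeta : R)
  (Pi : forall n : nat, T -> {set {set 'I_n}}) (w : nat -> R).
Hypothesis HPi : gnedin_partition P gamma zeta Pi.
Hypothesis cvg_v : forall k, gnedin_v gamma zeta n k.+1 * n`!%:R * n%:R ^+ k
  @[n --> \oo] --> w k.+1.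

Local Notation K := (nblocks_lim R Pi).

Definition nblocks_mass (m : nat) : R := w m / (m`!%:R * (m - 1)`!%:R).

Lemma cvg_term_bin (k : nat) :
  block_coef gamma zeta n k * 'C(n.-1, k)%:R @[n --> \oo] --> nblocks_mass k.+1.
Proof.
have idy : (fun n : nat => n) @ \oo --> \oo by exact: cvg_id.
rewrite /nblocks_mass subn1 /= invfM mulrA.
apply: (cvg_term (w := w) cvg_v (n := fun n => n)) => //.
have -> : k`!%:R^-1 = 1 ^+ k / k`!%:R :> R by rewrite expr1n mul1r.
apply: cvg_binomial => //.
have nn : n%:R / n%:R @[n --> \oo] --> (1 : R).
  apply: near_cvg_eq (cvg_cst _); near=> n; rewrite divff // pnatr_eq0 -lt0n.
  by near: n; exact: nbhs_infty_gt.
apply: (@cvg_ratio_close _ _ _ _ (fun n => n) _ _ 1 _ idy _ nn).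
by apply: nearW => n; split; lia.
Unshelve. all: by end_near. Qed.

Let leE (m : nat) : [set t | (K t <= m%:R%:E)%E]
  = \bigcap_n [set t | (#|Pi n t| <= m)%N].
Proof.
apply/seteqP; split => t /=.
  by move=> /(nblocks_lim_le HPi) h n _; exact: h.
by move=> h; apply/(nblocks_lim_le HPi) => n; exact: h.
Qed.

Lemma measurable_nblocks_le (m : nat) : measurable [set t | (K t <= m%:R%:E)%E].
Proof.
rewrite leE; apply: bigcap_measurable; first by exists 0%N.
by move=> n _; exact: (measurable_partition HPi (fun pi => #|pi| <= m)%N).
Qed.

(** The events |Pi_n| <= m decrease to the event that the limit is at most m, and each has as
    probability a sum of m terms, so the limit is taken term by term. At this stage mass may still
    escape to infinity. *)
Lemma prob_nblocks_le (m : nat) :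
  P [set t | (K t <= m%:R%:E)%E] = (\sum_(0 <= k < m) nblocks_mass k.+1)%:E.
Proof.
have h1 : (P \o (fun n => [set t | (#|Pi n t| <= m)%N])) @ \oo --> P [set t | (K t <= m%:R%:E)%E].
  rewrite leE; apply: nonincreasing_cvg_mu.
  - by apply: le_lt_trans (probability_le1 _ _) _; rewrite ?ltry //;
      exact: (measurable_partition HPi (fun pi => #|pi| <= m)%N).
  - by move=> n; exact: (measurable_partition HPi (fun pi => #|pi| <= m)%N).
  - by rewrite -leE; exact: measurable_nblocks_le.
  - move=> i j ij; apply/subsetPset => t /=; apply: leq_trans.
    exact: (card_Pi_homo HPi).
have h2 : (P \o (fun n => [set t | (#|Pi n t| <= m)%N])) @ \oo -->
    (\sum_(0 <= k < m) nblocks_mass k.+1)%:E.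
  have h : (\sum_(0 <= k < m) block_coef gamma zeta n k * 'C(n.-1, k)%:R)%:E @[n --> \oo]
     --> (\sum_(0 <= k < m) nblocks_mass k.+1)%:E.
    apply/fine_cvgP; split; first by apply: nearW.
    by apply: cvg_sumR => k _; exact: cvg_term_bin.
  apply: cvg_trans h; apply: near_eq_cvg; near=> n => /=.
  rewrite (prob_card_le HPi) //; near: n; first exact: nbhs_infty_gt.
  exact: nbhs_infty_ge.
by rewrite -(cvg_lim _ h1) // (cvg_lim _ h2).
Unshelve. all: by end_near. Qed.

Let eqE (m : nat) : [set t | K t = m.+1%:R%:E] =
  [set t | (K t <= m.+1%:R%:E)%E] `\` [set t | (K t <= m%:R%:E)%E].
Proof.
apply/seteqP; split => t /=.
  by move=> /(nblocks_lim_eq HPi)[/(nblocks_lim_le HPi) h1 h2]; split => // /(nblocks_lim_le HPi).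
move=> [/(nblocks_lim_le HPi) h1 h2]; apply/(nblocks_lim_eq HPi); split => // h.
by apply: h2; apply/(nblocks_lim_le HPi).
Qed.

Lemma measurable_nblocks_eq (m : nat) : measurable [set t | K t = m.+1%:R%:E].
Proof. by rewrite eqE; apply: measurableD; exact: measurable_nblocks_le. Qed.

Lemma prob_nblocks_eq (m : nat) : (0 < m)%N ->
  P [set t | K t = m%:R%:E] = (nblocks_mass m)%:E.
Proof.
case: m => // m _; rewrite eqE measureD //=; last 3 first.
- exact: measurable_nblocks_le.
- exact: measurable_nblocks_le.
- by apply: le_lt_trans (probability_le1 _ _) _; rewrite ?ltry //;
      exact: measurable_nblocks_le.
rewrite (_ : _ `&` _ = [set t | (K t <= m%:R%:E)%E]); last first.
  apply/setIidPr => t /= /le_trans; apply.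
  by rewrite lee_fin ler_nat.
rewrite !prob_nblocks_le -EFinB; congr EFin.
by rewrite big_nat_recr //= addrAC subrr add0r.
Qed.

Lemma nblocks_lim_infty (t : T) :
  K t = +oo%E <-> forall m : nat, ~ (K t <= m%:R%:E)%E.
Proof.
split => [-> m|]; first by rewrite leye_eq.
case: (K t) => [r| |] // h; exfalso; last by apply: (h 0%N); rewrite leNye.
by apply: (h (Num.truncn r).+1); rewrite lee_fin ltW // truncnS_gt.
Qed.

Lemma nblocks_lim_cases (t : T) : K t = +oo%E \/ exists m, K t = m.+1%:R%:E.
Proof.
have [[m0 hm0]|h] := pselect (exists m : nat, (K t <= m%:R%:E)%E); last first.
  by left; apply/nblocks_lim_infty => m hm; apply: h; exists m.
right; have ex : exists m, `[< forall n, (#|Pi n t| <= m)%N >].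
  by exists m0; apply/asboolP/(nblocks_lim_le HPi).
case: (ex_minnP ex) => -[|m] /asboolP hm mmin.
  (* The limit is never 0, because [Pi 1] already has a block. *)
  have := hm 1%N; rewrite leqNgt; case: HPi => + _ _ _ => /(_ 1%N t) p1.
  by have /andP[-> _] := card_set_partition (ltn0Sn 0) p1.
exists m; apply/(nblocks_lim_eq HPi); split => // h.
by have := mmin m; rewrite ltnn => /(_ (introT (asboolP _) h)).
Qed.

Lemma prob_nblocks_infty :
  (\sum_(0 <= k < N) nblocks_mass k.+1) @[N --> \oo] --> (1 : R) ->
  P [set t | K t = +oo%E] = 0%E.
Proof.
move=> h1.
have E : [set t | K t = +oo%E] = \bigcap_m ~` [set t | (K t <= m%:R%:E)%E].
  apply/seteqP; split => t /=; first by move=> /nblocks_lim_infty h m _; exact: h.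
  by move=> h; apply/nblocks_lim_infty => m; exact: h.
have mE : measurable [set t | K t = +oo%E].
  rewrite E; apply: bigcap_measurable; first by exists 0%N.
  by move=> m _; apply: measurableC; exact: measurable_nblocks_le.
apply/eqP; rewrite eq_le measure_ge0 andbT.
have hm m : (P [set t | K t = +oo%E] <= (1 - \sum_(0 <= k < m) nblocks_mass k.+1)%:E)%E.
  rewrite EFinB -prob_nblocks_le -probability_setC; last exact: measurable_nblocks_le.
  apply: le_measure; rewrite ?inE //.
    by apply: measurableC; exact: measurable_nblocks_le.
  by move=> t /= ->; rewrite leye_eq.
have h0 : (1 - \sum_(0 <= k < m) nblocks_mass k.+1)%:E @[m --> \oo] --> 0%E.
  apply/fine_cvgP; split; first by apply: nearW.
  have h2 : 1 - \sum_(0 <= k < m) nblocks_mass k.+1 @[m --> \oo] --> (1 - 1 : R).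
    by apply: cvgB => //; exact: cvg_cst.
  by rewrite subrr in h2; apply: near_cvg_eq h2; exact: nearW.
rewrite -(cvg_lim _ h0) //; apply: lime_ge; first exact: (cvgP _ h0).
exact: nearW.
Qed.

(** The value 0 of [inv_pow_bin] at infinity makes the expectation a series over the finite values,
    whether or not mass escapes. Termwise, (m + j - 1)! = C(m + j - 1, j) j! (m - 1)!. *)
Lemma expectation_inv_pow_bin (j : nat) (c : R) : (0 < j)%N ->
  j`!%:R * (\sum_(1 <= m < N) w m / (m`!%:R * (m + j - 1)`!%:R * m%:R ^+ j))
    @[N --> \oo] --> c ->
  'E_P[(fun t => inv_pow_bin j (K t))%R]%E = c%:E.
Proof.
move=> j0 hc; rewrite unlock.
pose f (m : nat) : R := inv_pow_bin j (m%:R%:E : \bar R).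
have f0 m : 0 <= f m by rewrite /f /= mulr_ge0 // invr_ge0 // exprn_ge0.
transitivity (\int[P]_t \sum_(0 <= m <oo) ((f m.+1)%:E * (\1_([set t | K t = m.+1%:R%:E]) t)%:E))%E.
  apply: eq_integral => t _.
  have [Ki|[m Km]] := nblocks_lim_cases t.
    rewrite Ki eseries0 // => i _ _; rewrite indicE memNset ?mule0 //=.
    by rewrite Ki.
  rewrite Km (@nneseriesD1 _ _ m) //=; last by move=> i _; rewrite -EFinM lee_fin mulr_ge0.
  rewrite eseries0 ?adde0; last first.
    move=> i _ im; rewrite indicE memNset ?mule0 //= Km => -[] /eqP.
    by rewrite eqr_nat eqSS eq_sym (negbTE im).
  by rewrite indicE mem_set // mule1.
rewrite integral_nneseries //; last 2 first.
- by move=> m; apply: measurable_funeM; apply/measurable_EFinP; apply: measurable_indic; exact: measurable_nblocks_eq.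
- by move=> m t _; rewrite -EFinM lee_fin mulr_ge0.
transitivity (limn (fun N => (\sum_(0 <= m < N) f m.+1 * nblocks_mass m.+1)%:E)).
  congr (limn _); apply/funext => N; rewrite -sumEFin; apply: eq_bigr => m _.
  rewrite ge0_integralZl_EFin //; last first.
    by apply/measurable_EFinP; apply: measurable_indic; exact: measurable_nblocks_eq.
  rewrite integral_indic //; last exact: measurable_nblocks_eq.
  by rewrite setIT [X in (_ * X)%E]prob_nblocks_eq.
apply: cvg_lim => //; apply/fine_cvgP; split; first by apply: nearW.
move: hc; rewrite -cvg_shiftS; apply: near_cvg_eq; apply: nearW => N /=.
rewrite big_add1 mulr_sumr /=; apply: eq_bigr => m _.
rewrite /f /nblocks_mass /inv_pow_bin natrK.
have [a ->] : exists a, j = a.+1 by exists j.-1; rewrite prednK.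
rewrite addSnnS !subn1 /= addnS /= -(bin_fact (leq_addl m a.+1)) addnK.
rewrite addnS; move: (fact_gt0 m) (fact_gt0 m.+1) (fact_gt0 a.+1).
have : (0 < 'C((m + a).+1, a.+1))%N by rewrite bin_gt0 ltnS leq_addl.
move: 'C(_, _) m`! (m.+1)`! (a.+1)`! => n1 n2 n3 n4.
rewrite !lt0n -!(pnatr_eq0 R) !natrM => n1_neq0 n2_neq0 n3_neq0 n4_neq0.
set c5 := m.+1%:R.
have c5_neq0 : c5 ^+ a.+1 != 0 :> R by rewrite expf_neq0 // pnatr_eq0.
move: (c5 ^+ a.+1) c5_neq0 => c6 c6_neq0.
by field; rewrite n1_neq0 n2_neq0 n3_neq0 n4_neq0 c6_neq0.
Qed.

End nblocks_limit.

(** * Convergence of the complex Gauss product *)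

Import ComplexField.Normc.

Section elementary_bounds.
Context {R : realType}.
Implicit Types u v : R.

Lemma sin_bound_ge0 v : 0 <= v -> `|sin v| <= v.
Proof.
move=> v0; have [c _ e] := @MVT_segment R sin cos 0 v v0
  (fun x _ => is_derive_sin x) (continuous_subspaceT (@continuous_sin R)).
rewrite sin0 !subr0 in e; rewrite e normrM (ger0_norm v0).
by rewrite ler_piMl // cos_max.
Qed.

Lemma cos_bound v : `|cos v - 1| <= v ^+ 2.
Proof.
wlog v0 : v / 0 <= v.
  move=> h; have [/h//|v0] := leP 0 v.
  by rewrite -cosN -sqrrN; apply: h; rewrite oppr_ge0 ltW.
have [c cv e] := @MVT_segment R cos (fun x => - sin x) 0 v v0
  (fun x _ => is_derive_cos x) (continuous_subspaceT (@continuous_cos R)).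
rewrite cos0 subr0 in e; rewrite e normrM normrN (ger0_norm v0) expr2.
move: cv; rewrite in_itv /= => /andP[c0 cv].
by rewrite ler_wpM2r // (le_trans (sin_bound_ge0 c0)).
Qed.

Lemma sin_bound v : `|v| <= 1 -> `|sin v - v| <= v ^+ 2.
Proof.
wlog v0 : v / 0 <= v.
  move=> h v1; have [v0|v0] := leP 0 v; first exact: h.
  have -> : sin v - v = - (sin (- v) - - v) by rewrite sinN; ring.
  rewrite normrN -sqrrN; apply: h; last by rewrite normrN.
  by rewrite oppr_ge0 ltW.
rewrite ger0_norm // => v1.
have [c cv e] := @MVT_segment R sin cos 0 v v0
  (fun x _ => is_derive_sin x) (continuous_subspaceT (@continuous_sin R)).
rewrite sin0 !subr0 in e; rewrite e -[X in _ - X]mul1r -mulrBl normrM (ger0_norm v0) expr2.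
move: cv; rewrite in_itv /= => /andP[c0 cv].
rewrite ler_wpM2r // (le_trans (cos_bound c)) // expr2.
by rewrite (le_trans _ cv) // ler_piMl // (le_trans cv).
Qed.

(** The upper bound inverts 1 - u <= exp (- u); for u <= 1 / 2, 1 / (1 - u) <= 1 + u + 2 u^2. *)
Lemma expR_bound u : `|u| <= 1 / 2 -> [/\ expR u <= 2, `|expR u - 1 - u| <= 2 * u ^+ 2
  & `|expR u - 1| <= 2 * `|u|].
Proof.
rewrite ler_norml => /andP[u1 u2].
have lb := expR_ge1Dx u; have lb' := expR_ge1Dx (- u).
have ub : expR u <= (1 - u)^-1.
  by rewrite -[expR u]invrK -expRN lef_pV2 ?posrE ?expR_gt0 //; lra.
have h1 : (1 - u)^-1 <= 1 + u + 2 * u ^+ 2.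
  rewrite -[leLHS]mul1r ler_pdivrMr; last by lra.
  rewrite -subr_ge0 (_ : _ - 1 = u ^+ 2 * (1 - 2 * u)); last by ring.
  by rewrite mulr_ge0 ?sqr_ge0 //; lra.
have h2 : expR u <= 2 by nra.
have h3 : `|expR u - 1 - u| <= 2 * u ^+ 2 by rewrite ger0_norm; lra.
split => //.
have [u0|u0] := leP 0 u.
  by rewrite ger0_norm ?(ger0_norm u0); nra.
rewrite (ltr0_norm u0) ler_norml; apply/andP; split; first by lra.
by have : expR u <= 1 by [rewrite -expR0 ler_expR ltW]; lra.
Qed.

End elementary_bounds.

Section complex_modulus.
Context {R : realType}.
Implicit Types z : R[i].

Lemma normc_ge0 z : 0 <= normc z.
Proof. by case: z => a b; exact: sqrtr_ge0. Qed.

Lemma Re_le_normc z : `|complex.Re z| <= normc z.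
Proof.
case: z => a b /=; rewrite -sqrtr_sqr; apply: ler_wsqrtr.
by rewrite lerDl sqr_ge0.
Qed.

Lemma Im_le_normc z : `|complex.Im z| <= normc z.
Proof.
case: z => a b /=; rewrite -sqrtr_sqr; apply: ler_wsqrtr.
by rewrite lerDr sqr_ge0.
Qed.

Lemma normc_le_ReIm z : normc z <= `|complex.Re z| + `|complex.Im z|.
Proof.
case: z => a b /=.
rewrite -[leRHS]ger0_norm ?addr_ge0 // -sqrtr_sqr; apply: ler_wsqrtr.
rewrite sqrrD !real_normK ?num_real // addrAC lerDl.
by rewrite mulrn_wge0 // mulr_ge0.
Qed.

Lemma normc_gt0 z : z != 0 -> 0 < normc z.
Proof.
move=> z0; rewrite lt_neqAle normc_ge0 andbT eq_sym.
by apply: contra z0 => /eqP/eq0_normc ->.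
Qed.

Lemma normcR (x : R) : normc x%:C = `|x|.
Proof. by rewrite /= expr0n addr0 sqrtr_sqr. Qed.

End complex_modulus.

Section summable_increments.
Context {R : realType}.

Let step (n : nat) : R := n%:R^-1 - n.+1%:R^-1.

Lemma step_ge0 (n : nat) : (0 < n)%N -> 0 <= step n.
Proof. by move=> n0; rewrite subr_ge0 lef_pV2 ?posrE ?ltr0n // ler_nat. Qed.

Lemma telescope_le (b : nat -> R) (N n : nat) : (N <= n)%N ->
  (forall m, (N <= m)%N -> b m.+1 <= b m) -> b n <= b N.
Proof.
move=> Nn h; rewrite -(subnKC Nn); elim: (n - N)%N => [|m IH]; first by rewrite addn0.
by rewrite addnS (le_trans _ IH) // h // leq_addr.
Qed.

(** [step] telescopes, so from N on v n + D / n is nonincreasing while v n - D / n is nondecreasing,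
    which bounds the former from below. *)
Lemma cvg_summable_increments (v : nat -> R) (D : R) (N : nat) : (0 < N)%N ->
  (forall n, (N <= n)%N -> `|v n.+1 - v n| <= D * step n) -> cvgn v.
Proof.
move=> N0 h.
have hn n : (0 < n)%N -> 0 < (n%:R : R) by rewrite ltr0n.
pose a n := v (n + N)%N + D / (n + N)%:R.
have /cvg_ex[l al] : cvgn a.
  apply: nonincreasing_is_cvgn.
    apply/nonincreasing_seqP => n.
    have := h (n + N)%N (leq_addl _ _); rewrite ler_norml => /andP[_].
    rewrite /a /step addSn mulrBr; move: (D / _) (D / _) => x y; lra.
  exists (v N - D / N%:R) => _ [n _ <-].
  have := @telescope_le (fun n => - (v n - D / n%:R)) N (n + N)%N (leq_addl _ _).
  rewrite lerN2 => /(_ _)/le_trans; apply => [m Nm|].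
    have := h m Nm; rewrite ler_norml /step mulrBr => /andP[+ _].
    by move: (D / _) (D / _) => x y; lra.
  have D0 : 0 <= D.
    have := h N (leqnn N); have := normr_ge0 (v N.+1 - v N) => /le_trans /[apply].
    rewrite pmulr_lge0 // subr_gt0 ltf_pV2 ?posrE ?ltr0n //.
    by rewrite ltr_nat.
  rewrite /a; have : 0 <= D / (n + N)%:R by rewrite divr_ge0.
  by move: (D / _) => x; lra.
apply/cvg_ex; exists l.
rewrite -(cvg_shiftn N).
have DN : D / (n + N)%:R @[n --> \oo] --> (0 : R).
  rewrite -(mulr0 D); apply: cvgM; first exact: cvg_cst.
  exact: (cvg_natV (cvg_addnr N)).
have {}al : a n - D / (n + N)%:R @[n --> \oo] --> l - 0 by exact: cvgB.
rewrite subr0 in al; apply: near_cvg_eq al; apply: nearW => n.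
by rewrite /a addrK.
Qed.

(** The componentwise form matches [cGamma], which takes the limits of the real and imaginary parts
    separately. *)
Definition ccvg (g : nat -> R[i]) (l : R[i]) : Prop :=
  complex.Re (g n) @[n --> \oo] --> complex.Re l /\
  complex.Im (g n) @[n --> \oo] --> complex.Im l.

(* normc (g n) * expR (C / n) decreases and normc (g n) * expR (- 2 C / n)
   increases, so the moduli stay away from 0 and infinity. *)
Lemma ccvg_summable_increments (g : nat -> R[i]) (C : R) (N : nat) :
  (0 < N)%N -> 0 <= C ->
  (forall n, (N <= n)%N -> g n != 0) ->
  (forall n, (N <= n)%N -> normc (g n.+1 - g n) <= C * step n * normc (g n)) ->
  exists2 l, l != 0 & ccvg g l.
Proof.
move=> N0 C0 g0 h.
have up n : (N <= n)%N -> normc (g n.+1) <= (1 + C * step n) * normc (g n).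
  move=> Nn; rewrite mulrDl mul1r -[g n.+1](subrK (g n)) addrC.
  by rewrite (le_trans (le_normcD _ _)) // lerD2l h.
have lo n : (N <= n)%N -> (1 - C * step n) * normc (g n) <= normc (g n.+1).
  move=> Nn; rewrite mulrBl mul1r lerBlDr.
  rewrite -[X in normc X <= _](subrK (g n.+1)) addrC.
  by rewrite (le_trans (le_normcD _ _)) // lerD2l -normcN opprB h.
pose B := normc (g N) * expR (C / N%:R).
have gB n : (N <= n)%N -> normc (g n) <= B.
  move=> Nn; apply: (@le_trans _ _ (normc (g n) * expR (C / n%:R))).
    by rewrite ler_peMr ?normc_ge0 // -expR0 ler_expR divr_ge0.
  apply: (@telescope_le (fun n => normc (g n) * expR (C / n%:R)) _ _ Nn) => m Nm.
  have -> : C / m%:R = C * step m + C / m.+1%:R by rewrite /step; ring.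
  rewrite expRD mulrA ler_wpM2r ?expR_ge0 // (le_trans (up m Nm)) //.
  by rewrite mulrC ler_wpM2l ?normc_ge0 // expR_ge1Dx.
have incr n : (N <= n)%N -> normc (g n.+1 - g n) <= C * B * step n.
  move=> Nn; apply: le_trans (h n Nn) _; rewrite mulrAC ler_wpM2r //.
    by rewrite step_ge0 // (leq_trans N0).
  by rewrite ler_wpM2l // gB.
have /cvg_ex[a ga] : cvgn (fun n => complex.Re (g n)).
  apply: (@cvg_summable_increments _ (C * B) N) => // n Nn.
  apply: le_trans (incr n Nn); apply: le_trans (Re_le_normc _).
  by rewrite raddfB.
have /cvg_ex[b gb] : cvgn (fun n => complex.Im (g n)).
  apply: (@cvg_summable_increments _ (C * B) N) => // n Nn.
  apply: le_trans (incr n Nn); apply: le_trans (Im_le_normc _).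
  by rewrite raddfB.
exists (a +i* b); last by split.
(* From M on, y = C [step] m is at most 1 / 2, where 1 - y >= exp (- 2 y). *)
have [M NM MC] : exists2 M, (N <= M)%N & 2 * C <= M%:R.
  exists (maxn N (Num.truncn (2 * C)).+1); first exact: leq_maxl.
  by rewrite (le_trans (ltW (truncnS_gt _))) // ler_nat leq_maxr.
have M0 := leq_trans N0 NM.
pose c := normc (g M) * expR (- (2 * C) / M%:R).
have c0 : 0 < c by rewrite mulr_gt0 ?expR_gt0 // normc_gt0 // g0.
have gc n : (M <= n)%N -> c <= normc (g n).
  move=> Mn; have n0 := leq_trans M0 Mn.
  apply: (@le_trans _ _ (normc (g n) * expR (- (2 * C) / n%:R))); last first.
    by rewrite ler_piMr ?normc_ge0 // -expR0 ler_expR mulNr oppr_le0 divr_ge0 // mulr_ge0.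
  have := @telescope_le (fun n => - (normc (g n) * expR (- (2 * C) / n%:R))) _ _ Mn.
  rewrite lerN2; apply => m Mm; rewrite lerN2.
  have m0 := leq_trans M0 Mm; have Nm := leq_trans NM Mm.
  have -> : - (2 * C) / m%:R = - (2 * (C * step m)) + - (2 * C) / m.+1%:R by rewrite /step; ring.
  rewrite expRD [leLHS]mulrA ler_wpM2r ?expR_ge0 // (le_trans _ (lo m Nm)) //.
  rewrite [leRHS]mulrC ler_wpM2l ?normc_ge0 // expRN.
  have y0 : 0 <= C * step m by rewrite mulr_ge0 // step_ge0.
  have y1 : 2 * (C * step m) <= 1.
    rewrite mulrA; apply: (@le_trans _ _ (M%:R * m%:R^-1)).
      rewrite ler_pM ?mulr_ge0 ?step_ge0 // gerBl invr_ge0.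
      exact: ler0n.
    by rewrite ler_pdivrMr ?ltr0n // mul1r ler_nat.
  move: (C * step m) y0 y1 => y y0 y1.
  rewrite -[leLHS]mul1r ler_pdivrMr ?expR_gt0 //.
  apply: (@le_trans _ _ ((1 - y) * (1 + 2 * y))).
    rewrite -subr_ge0 (_ : _ - 1 = y * (1 - 2 * y)); last by ring.
    by rewrite mulr_ge0 // subr_ge0.
  by rewrite ler_wpM2l ?expR_ge1Dx //; lra.
have : c <= `|a| + `|b|.
  have hlim : `|complex.Re (g n)| + `|complex.Im (g n)| @[n --> \oo] --> `|a| + `|b|.
    by apply: cvgD; apply: cvg_norm.
  rewrite -(cvg_lim (@Rhausdorff R) hlim); apply: limr_ge.
    exact: (cvgP _ hlim).
  exists M => // n /= Mn; exact: le_trans (gc n Mn) (normc_le_ReIm _).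
move=> ab; apply: contraTneq c0 => -[a0 b0].
by rewrite -leNgt (le_trans ab) // a0 b0 normr0 addr0.
Qed.

End summable_increments.

Section gauss_limit.
Context {R : realType}.
Implicit Types z : R[i].

(** This is exp (z l). With a free real l in place of ln n it is multiplicative in l, which gives
    the quotients of consecutive powers n^z. *)
Definition cexp z (l : R) : R[i] :=
  (expR (complex.Re z * l))%:C
  * (cos (complex.Im z * l) +i* sin (complex.Im z * l)).

Lemma cpow_natE (n : nat) z : cpow_nat n z = cexp z (ln n%:R).
Proof. by []. Qed.

Lemma cexpD z (l m : R) : cexp z (l + m) = cexp z l * cexp z m.
Proof.
rewrite /cexp !mulrDr expRD cosD sinD rmorphM /= mulrACA; congr (_ * _).
by apply/eqP; rewrite eq_complex /=; apply/andP; split; apply/eqP; ring.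
Qed.

Lemma cexp_neq0 z (l : R) : cexp z l != 0.
Proof.
apply/eqP => /(congr1 (fun u => cexp z (- l) * u)); rewrite -cexpD addNr mulr0.
rewrite /cexp !mulr0 expR0 cos0 sin0 mul1r => -[/eqP].
by rewrite oner_eq0.
Qed.

(** With u and v the real and imaginary parts of z l, the real part of the remainder is at most 2
    u^2 + 2 v^2 and the imaginary part at most u^2 + 3 v^2. *)
Lemma cexp_bound z (l : R) : `|complex.Re z * l| <= 1 / 2 ->
  `|complex.Im z * l| <= 1 / 2 ->
  normc (cexp z l - 1 - z * l%:C)
    <= (3 * complex.Re z ^+ 2 + 5 * complex.Im z ^+ 2) * l ^+ 2.
Proof.
case: z => x y; rewrite /cexp [complex.Re _]/= [complex.Im _]/=.
have -> : (3 * x ^+ 2 + 5 * y ^+ 2) * l ^+ 2 = 3 * (x * l) ^+ 2 + 5 * (y * l) ^+ 2 by ring.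
move=> u1 v1; rewrite [X in normc X <= _](_ : _ = (expR (x * l) * cos (y * l) - 1 - x * l)
    +i* (expR (x * l) * sin (y * l) - y * l)); last first.
  by apply/eqP; rewrite eq_complex /=; apply/andP; split; apply/eqP; ring.
move: (x * l) (y * l) u1 v1 => u v u1 v1.
have [e2 e1 e0] := expR_bound u1.
have c1 := cos_bound v; have s1 : `|sin v - v| <= v ^+ 2 by apply: sin_bound; lra.
apply: le_trans (normc_le_ReIm _) _ => /=.
have h1 : `|expR u * cos v - 1 - u| <= 2 * v ^+ 2 + 2 * u ^+ 2.
  have -> : expR u * cos v - 1 - u = expR u * (cos v - 1) + (expR u - 1 - u) by ring.
  rewrite (le_trans (ler_normD _ _)) // lerD // normrM (ger0_norm (expR_ge0 _)).
  by rewrite ler_pM ?expR_ge0.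
have h2 : `|expR u * sin v - v| <= 2 * v ^+ 2 + 2 * `|u| * `|v|.
  have -> : expR u * sin v - v = expR u * (sin v - v) + (expR u - 1) * v by ring.
  rewrite (le_trans (ler_normD _ _)) // lerD // normrM ?(ger0_norm (expR_ge0 _)).
    by rewrite ler_pM ?expR_ge0.
  by rewrite ler_wpM2r.
have h3 : 2 * `|u| * `|v| <= u ^+ 2 + v ^+ 2.
  rewrite -(real_normK (num_real u)) -(real_normK (num_real v)) -subr_ge0.
  rewrite (_ : _ - _ = (`|u| - `|v|) ^+ 2) ?sqr_ge0 //; ring.
by move: (u ^+ 2) (v ^+ 2) h1 h2 h3 => a b; lra.
Qed.

Lemma gauss_gammaS z (n : nat) : (0 < n)%N -> z + n.+1%:R != 0 ->
  gauss_gamma z n.+1 * (z + n.+1%:R)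
  = n.+1%:R * cexp z (ln n.+1%:R - ln n%:R) * gauss_gamma z n.
Proof.
move=> n0 zn; rewrite /gauss_gamma !cpow_natE.
have -> : cexp z (ln n.+1%:R) = cexp z (ln n.+1%:R - ln n%:R) * cexp z (ln n%:R).
  by rewrite -cexpD subrK.
move: (cexp z _) (cexp z _) => c1 c2; rewrite factS natrM big_ord_recr /= invfM.
have key (a b c d e f : R[i]) : f != 0 -> a * b * (c * d) * (e * f^-1) * f = a * c * (b * d * e).
  by move=> f0; field.
by rewrite key.
Qed.

Lemma ln_step (n : nat) : (0 < n)%N ->
  (n.+1%:R)^-1 <= ln (n.+1%:R : R) - ln n%:R <= n%:R^-1.
Proof.
move=> n0; have n1 : 0 < n%:R :> R by rewrite ltr0n.
have n2 : 0 < n.+1%:R :> R by rewrite ltr0n.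
rewrite -ln_div ?posrE //; apply/andP; split.
  have : ln (1 + (- n.+1%:R^-1)) <= - n.+1%:R^-1 :> R.
    by apply: le_ln1Dx; rewrite ltrN2 invf_lt1 // ltr1n.
  rewrite lerNr -lnV; last by rewrite posrE subr_gt0 invf_lt1 // ltr1n.
  suff -> : (1 - n.+1%:R^-1)^-1 = n.+1%:R / n%:R :> R by [].
  rewrite -[RHS]invf_div; congr _^-1; rewrite -natr1; field.
  by rewrite natr1 pnatr_eq0.
have -> : n.+1%:R / n%:R = 1 + n%:R^-1 :> R.
  by rewrite -natr1 mulrDl divff ?lt0r_neq0 // mul1r.
by apply: le_ln1Dx; rewrite (lt_trans (ltrN10 _)) // invr_gt0.
Qed.

Lemma gauss_gamma_neq0 z (n : nat) : (forall i : nat, z + i%:R != 0) ->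
  gauss_gamma z n != 0.
Proof.
move=> z0; rewrite /gauss_gamma cpow_natE; apply: mulf_neq0.
  apply: mulf_neq0; last exact: cexp_neq0.
  by rewrite pnatr_eq0 -lt0n fact_gt0.
by rewrite invr_neq0 //; apply/prodf_neq0 => i _.
Qed.

Lemma normc_natr (n : nat) : normc (n%:R : R[i]) = n%:R.
Proof. by rewrite -(rmorph_nat (real_complex R)) normcR normr_nat. Qed.

(** The ratio of consecutive terms is (n + 1) exp (z dl) / (z + n + 1) with dl = ln (n + 1) - ln n.
    In [key] the first-order terms cancel up to z ((n + 1) dl - 1) = O(1 / n), so the ratio is 1 +
    O(1 / n^2). *)
Lemma ccvg_gauss_gamma z : (forall i : nat, z + i%:R != 0) ->
  exists2 l, l != 0 & ccvg (gauss_gamma z) l.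
Proof.
move=> z0; set c := normc z; have c0 : 0 <= c by exact: normc_ge0.
pose C0 := 3 * complex.Re z ^+ 2 + 5 * complex.Im z ^+ 2.
have C00 : 0 <= C0 by rewrite addr_ge0 // mulr_ge0 // sqr_ge0.
(* For n >= N > 2 |z|, both |z| dl <= 1 / 2, as [cexp_bound] requires, and |z + n + 1| >= (n + 1) /
   2. *)
pose N := (Num.truncn (2 * c)).+1.
apply: (@ccvg_summable_increments _ _ (4 * C0 + 2 * c) N) => //.
- by rewrite addr_ge0 // mulr_ge0.
- by move=> n _; exact: gauss_gamma_neq0.
move=> n Nn; have n0 : (0 < n)%N by exact: leq_trans Nn.
have nc : 2 * c <= n%:R.
  by rewrite (le_trans (ltW (truncnS_gt _))) // ler_nat.
have nr0 : 0 < n%:R :> R by rewrite ltr0n.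
have n1r : n.+1%:R = n%:R + 1 :> R by rewrite natr1.
have /andP[d1 d2] := ln_step n0; set dl := ln _ - ln _ in d1 d2.
have dl0 : 0 <= dl by rewrite (le_trans _ d1) // invr_ge0.
have small (x : R) : `|x| <= c -> `|x * dl| <= 1 / 2.
  move=> xc; rewrite normrM (ger0_norm dl0).
  apply: (@le_trans _ _ (c * n%:R^-1)); first by rewrite ler_pM.
  by rewrite ler_pdivrMr //; lra.
have E := cexp_bound (small _ (Re_le_normc z)) (small _ (Im_le_normc z)).
rewrite -/C0 in E; have {}E : normc (cexp z dl - 1 - z * dl%:C) <= C0 / n%:R ^+ 2.
  apply: le_trans E _; rewrite ler_wpM2l // -exprVn ler_pXn2r ?nnegrE ?invr_ge0 //.
have key : (gauss_gamma z n.+1 - gauss_gamma z n) * (z + n.+1%:R) =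
    gauss_gamma z n * (n.+1%:R * (cexp z dl - 1 - z * dl%:C) + z * (n.+1%:R * dl%:C - 1)).
  by rewrite mulrBl gauss_gammaS // -/dl; ring.
move: (gauss_gamma z n.+1) (gauss_gamma z n) key => g1 g key.
have {}key : normc (g1 - g) * normc (z + n.+1%:R) = normc g *
    normc (n.+1%:R * (cexp z dl - 1 - z * dl%:C) + z * (n.+1%:R * dl%:C - 1)).
  by rewrite -!normcM key.

have lbz : (n%:R + 1) / 2 <= normc (z + n.+1%:R).
  have : normc (n.+1%:R : R[i]) <= normc (z + n.+1%:R) + normc z.
    rewrite -(normcN z) -[X in normc X <= _](addrK z) [_ + z]addrC.
    exact: le_normcD.
  by rewrite normc_natr n1r -/c; lra.
have ubz : normc (n.+1%:R * (cexp z dl - 1 - z * dl%:C) + z * (n.+1%:R * dl%:C - 1))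
   <= (n%:R + 1) * (C0 / n%:R ^+ 2) + c / n%:R.
  rewrite (le_trans (le_normcD _ _)) // !normcM normc_natr n1r lerD //.
    by rewrite ler_wpM2l // addr_ge0.
  rewrite ler_wpM2l //.
  have -> : n.+1%:R * dl%:C - 1 = (n.+1%:R * dl - 1)%:C.
    rewrite -(rmorph_nat (real_complex R)); apply/eqP; rewrite eq_complex /=.
    by apply/andP; split; apply/eqP; ring.
  rewrite normcR ger0_norm n1r; last first.
    by rewrite subr_ge0 -ler_pdivrMl ?mulr1 -?n1r // ltr0n.
  rewrite lerBlDr -ler_pdivlMl; last by rewrite -n1r ltr0n.
  apply: le_trans d2 _; rewrite le_eqVlt; apply/orP; left; apply/eqP.
  by field; rewrite lt0r_neq0 //= -n1r pnatr_eq0.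
have gn0 := normc_ge0 g.
rewrite -(@ler_pM2r _ ((n%:R + 1) / 2)); last by rewrite divr_gt0 // ltr_wpDl.
apply: le_trans (ler_wpM2l (normc_ge0 _) lbz) _; rewrite key.
apply: le_trans (ler_wpM2l gn0 ubz) _.
rewrite [leRHS]mulrAC [leRHS]mulrC ler_wpM2l // n1r.
have x1 : 1 <= n%:R :> R by rewrite ler1n.
move: (n%:R : R) nr0 x1 => x x0 x1; have xn0 := lt0r_neq0 x0.
have x1n0 : x + 1 != 0 by rewrite lt0r_neq0 // addr_gt0.
have -> : (4 * C0 + 2 * c) * (x^-1 - (x + 1)^-1) * ((x + 1) / 2) = 2 * C0 / x + c / x.
  by field; rewrite xn0.
rewrite lerD2r mulrA ler_pdivrMr ?exprn_gt0 // (_ : _ / _ * _ = 2 * C0 * x); last by field.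
by rewrite -subr_ge0 (_ : _ - _ = C0 * (x - 1)); [rewrite mulr_ge0 ?subr_ge0|ring].
Qed.

End gauss_limit.

Section ccvg_theory.
Context {R : realType}.
Implicit Types (g h : nat -> R[i]) (l m z : R[i]).

Lemma ccvgM g h l m : ccvg g l -> ccvg h m -> ccvg (fun n => g n * h n) (l * m).
Proof.
move=> [gr gi] [hr hi].
have ReM (a b : R[i]) : complex.Re (a * b) = complex.Re a * complex.Re b - complex.Im a * complex.Im b.
  by case: a b => [? ?] [? ?].
have ImM (a b : R[i]) : complex.Im (a * b) = complex.Re a * complex.Im b + complex.Im a * complex.Re b.
  by case: a b => [? ?] [? ?].
split; [rewrite ReM; under eq_cvg do rewrite ReM|rewrite ImM; under eq_cvg do rewrite ImM].
  by apply: cvgB; apply: cvgM.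
by apply: cvgD; apply: cvgM.
Qed.

Lemma ccvgD g h l m : ccvg g l -> ccvg h m -> ccvg (fun n => g n + h n) (l + m).
Proof.
move=> [gr gi] [hr hi]; split; rewrite raddfD; under eq_cvg do rewrite raddfD; exact: cvgD.
Qed.

Lemma ccvg_cst l : ccvg (fun=> l) l.
Proof. by split; exact: cvg_cst. Qed.

Lemma ccvgR (v : nat -> R) (x : R) : v @ \oo --> x ->
  ccvg (fun n => (v n)%:C) x%:C.
Proof. by move=> vx; split => //=; exact: cvg_cst. Qed.

Lemma ccvg_unique g l m : ccvg g l -> ccvg g m -> l = m.
Proof.
move=> [gr gi] [hr hi]; apply/eqP; rewrite eq_complex.
have -> := cvg_unique (@Rhausdorff R) gr hr; rewrite eqxx /=.
by rewrite (cvg_unique (@Rhausdorff R) gi hi).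
Qed.

Lemma cGamma_eq z l : ccvg (gauss_gamma z) l -> cGamma z = l.
Proof.
move=> [gr gi]; rewrite /cGamma (cvg_lim (@Rhausdorff R) gr).
by rewrite (cvg_lim (@Rhausdorff R) gi); case: l {gr gi}.
Qed.

Lemma cexpDl (z z' : R[i]) (l : R) : cexp (z + z') l = cexp z l * cexp z' l.
Proof.
rewrite /cexp !raddfD /= !mulrDl expRD cosD sinD rmorphM /= mulrACA; congr (_ * _).
by apply/eqP; rewrite eq_complex /=; apply/andP; split; apply/eqP; ring.
Qed.

Lemma cexpR (x l : R) : cexp x%:C l = (expR (x * l))%:C.
Proof. by rewrite /cexp /= mul0r cos0 sin0 mulr1. Qed.

Lemma cexp1 (n : nat) : (0 < n)%N -> @cexp R 1 (ln n%:R) = n%:R.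
Proof.
move=> n0; rewrite -(rmorph1 (real_complex R)) cexpR mul1r lnK ?posrE ?ltr0n //.
exact: rmorph_nat.
Qed.

Lemma gauss_gamma_real (x : R) (n : nat) : gauss_gamma x%:C n
  = (n`!%:R * expR (x * ln n%:R) / \prod_(i < n.+1) (x + i%:R))%:C.
Proof.
rewrite /gauss_gamma cpow_natE cexpR.
rewrite !(rmorphM (real_complex R)) /= fmorphV rmorph_prod rmorph_nat.
by congr (_ / _); apply: eq_bigr => i _; rewrite rmorphD rmorph_nat.
Qed.

Lemma cGamma0 : @cGamma R 0 = 0.
Proof.
apply: cGamma_eq; rewrite (_ : @gauss_gamma R 0 = fun=> 0); first exact: ccvg_cst.
apply/funext => n; rewrite /gauss_gamma big_ord_recl /= addr0 mul0r invr0.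
by rewrite mulr0.
Qed.

(** The n-th Gauss approximations satisfy the functional equation up to the factor (z + n + 1) / n =
    1 + (1 + z) / n, which tends to 1. *)
Lemma cGamma_add1 z : (forall i : nat, z + i%:R != 0) ->
  cGamma (1 + z) = z * cGamma z.
Proof.
move=> z0; have [l l0 gl] := ccvg_gauss_gamma z0.
have z10 (i : nat) : 1 + z + i%:R != 0.
  by rewrite addrAC [1 + _]nat1r addrC z0.
have [l1 l10 gl1] := ccvg_gauss_gamma z10.
rewrite (cGamma_eq gl) (cGamma_eq gl1).
have h1 : ccvg (fun n => gauss_gamma (1 + z) n * (1 + (1 + z) * (n%:R^-1)%:C)) (l1 * (1 + (1 + z) * 0%:C)).
  apply: ccvgM => //; apply: ccvgD; first exact: ccvg_cst.
  by apply: ccvgM; [exact: ccvg_cst|apply/ccvgR/cvg_natV; exact: cvg_id].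
have h2 : ccvg (fun n => z * gauss_gamma z n) (z * l) by apply: ccvgM => //; exact: ccvg_cst.
rewrite mulr0 addr0 mulr1 in h1.
apply: (ccvg_unique h1); move: h2.
suff e : \forall n \near \oo, gauss_gamma (1 + z) n * (1 + (1 + z) * (n%:R^-1)%:C) = z * gauss_gamma z n.
  by move=> [hr hi]; split; [apply: near_cvg_eq hr|apply: near_cvg_eq hi];
    apply: filterS e => n ->.
exists 1%N => // n /= n0; have nn0 : n%:R != 0 :> R[i] by rewrite pnatr_eq0 -lt0n.
rewrite /gauss_gamma !cpow_natE cexpDl cexp1 //.
rewrite big_ord_recr [in RHS]big_ord_recl /= addr0.
rewrite [in RHS](eq_bigr (fun i : 'I_n => 1 + z + i%:R)); last first.
  by move=> i _; rewrite /bump /= add1n -nat1r addrA [z + 1]addrC.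
have P0 : \prod_(i < n) (1 + z + i%:R) != 0 by apply/prodf_neq0 => i _.
rewrite (fmorphV (real_complex R)) (rmorph_nat (real_complex R)).
have := z10 n; have := z0 0%N; rewrite addr0.
move: (cexp z _) (\prod_(i < n) _) P0 n`!%:R (n%:R : R[i]) nn0 => c p p0 f x x0 zn0 zn1.
by field; rewrite x0 p0 zn0 zn1.
Qed.

End ccvg_theory.

(** * ** The constant A and the asymptotics of v *)

Section beta_constant.
Context {R : realType} (gamma zeta : R) (z1 z2 s1 s2 : R[i]).
Hypothesis gamma0 : 0 <= gamma.
Hypothesis pos : forall j : nat, (1 <= j)%N ->
  0 < j%:R ^+ 2 - gamma * j%:R + zeta.
Hypotheses (z12 : z1 * z2 = zeta%:C) (s12 : s1 * s2 = zeta%:C)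
  (z1D2 : z1 + z2 = gamma%:C) (s1D2 : - (s1 + s2) = gamma%:C).

Let c (j : nat) : R := j%:R ^+ 2 + gamma * j%:R + zeta.

Definition numer (k : nat) : R :=
  \prod_(1 <= j < k.+1) (j%:R ^+ 2 - gamma * j%:R + zeta).

Lemma denom_gt0 (j : nat) : (1 <= j)%N -> 0 < c j.
Proof.
move=> /pos; rewrite /c; have : 0 <= gamma * j%:R by rewrite mulr_ge0.
by move: (gamma * _) (_ ^+ 2) => x y; lra.
Qed.

Lemma numer_gt0 (k : nat) : 0 < numer k.
Proof.
rewrite /numer big_nat; apply: prodr_gt0 => j /andP[j1 _]; exact: pos.
Qed.

Let zc (j : nat) : (z1 + j%:R) * (z2 + j%:R) = (c j)%:C.
Proof.
have -> : (z1 + j%:R) * (z2 + j%:R) = z1 * z2 + (z1 + z2) * j%:R + j%:R ^+ 2 by ring.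
rewrite z12 z1D2 -(rmorph_nat (real_complex R)) -rmorphM -rmorphXn -!rmorphD /=.
by congr (_%:C); rewrite /c; ring.
Qed.

Let sc (j : nat) : (s1 + j%:R) * (s2 + j%:R) = (j%:R ^+ 2 - gamma * j%:R + zeta)%:C.
Proof.
have -> : (s1 + j%:R) * (s2 + j%:R) = s1 * s2 - (- (s1 + s2)) * j%:R + j%:R ^+ 2 by ring.
rewrite s12 s1D2 -(rmorph_nat (real_complex R)) -rmorphM -rmorphXn -rmorphB -!rmorphD /=.
by congr (_%:C); ring.
Qed.

Let nat1z (z : R[i]) (i : nat) : 1 + z + i%:R = z + i.+1%:R.
Proof. by rewrite -nat1r addrCA addrA. Qed.

Let z_neq0 (j : nat) : (1 <= j)%N -> (z1 + j%:R != 0) /\ (z2 + j%:R != 0).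
Proof.
move=> j1; apply/andP; rewrite -negb_or -mulf_eq0 zc.
by rewrite -[0]/(0%:C) (inj_eq (@complexI R)) ?lt0r_neq0 // denom_gt0.
Qed.

(* n-th Gauss approximation of Gamma(1 + z1) Gamma(1 + z2) / Gamma(gamma). *)
Definition gauss_ratio (n : nat) : R :=
  n`!%:R * n%:R ^+ 2 * poch gamma n.+1 / \prod_(1 <= j < n.+2) c j.

Lemma poch_gt0 (x : R) (n : nat) : 0 < x -> 0 < poch x n.
Proof. by move=> x0; apply: prodr_gt0 => i _; rewrite ltr_wpDr. Qed.

(** The powers n^z1 n^z2 = n^gamma cancel against those of Gamma(gamma), the shifts 1 + z1 and 1 +
    z2 leave n^2, and the factors pair into the real numbers (z1 + j) (z2 + j). *)
Lemma gauss_ratioE (n : nat) : 0 < gamma -> (0 < n)%N ->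
  gauss_gamma (1 + z1) n * gauss_gamma (1 + z2) n
  = (gauss_ratio n)%:C * gauss_gamma gamma%:C n.
Proof.
move=> g0 n0; rewrite gauss_gamma_real /gauss_gamma !cpow_natE !cexpDl cexp1 //.
rewrite -/(poch gamma n.+1).
have cc : cexp z1 (ln n%:R) * cexp z2 (ln n%:R) = (expR (gamma * ln n%:R))%:C.
  by rewrite -cexpDl z1D2 cexpR.
have PP : (\prod_(i < n.+1) (1 + z1 + i%:R)) * (\prod_(i < n.+1) (1 + z2 + i%:R))
    = (\prod_(1 <= j < n.+2) c j)%:C.
  rewrite big_add1 /= big_mkord rmorph_prod -big_split /=.
  by apply: eq_bigr => i _; rewrite !nat1z zc.
rewrite mulrACA -invfM PP [_ * (n%:R * _) * _]mulrACA [n%:R * _ * _]mulrACA cc.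
have p0 : poch gamma n.+1 != 0 by rewrite lt0r_neq0 // poch_gt0.
rewrite /gauss_ratio -(rmorph_nat (real_complex R)) -(rmorph_nat (real_complex R) n).
rewrite -fmorphV -!(rmorphM (real_complex R)) /=; congr (_%:C); move: p0.
move: (poch _ _) (\prod_(_ <= _ < _) _)^-1 (expR _) n`!%:R => p q e f p0.
by field.
Qed.

(** For gamma = 0 both sides are 0: (0)_(n+1) = 0, and 1 / [cGamma] is 0 at the pole 0. For gamma >
    0 the three Gauss limits are nonzero, so A is nonzero, and it is a limit of nonnegative
    numbers. *)
Lemma cvg_gauss_ratio : exists A : R, [/\ gauss_ratio @ \oo --> A,
  cGamma (1 + z1) * cGamma (1 + z2) / cGamma (z1 + z2) = A%:C
  & 0 < gamma -> 0 < A].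
Proof.
have := gamma0; rewrite le_eqVlt => /predU1P[g0|g0].
  exists 0; split; last by rewrite -g0 ltxx.
    rewrite (_ : gauss_ratio = fun=> 0); first exact: cvg_cst.
    apply/funext => n; rewrite /gauss_ratio /poch -g0 big_ord_recl addr0 mul0r.
    by rewrite mulr0 mul0r.
  by rewrite z1D2 -g0 cGamma0 invr0 mulr0.
have [l1 l10 h1] : exists2 l, l != 0 & ccvg (gauss_gamma (1 + z1)) l.
  by apply: ccvg_gauss_gamma => i; rewrite nat1z; have [] := @z_neq0 i.+1 isT.
have [l2 l20 h2] : exists2 l, l != 0 & ccvg (gauss_gamma (1 + z2)) l.
  by apply: ccvg_gauss_gamma => i; rewrite nat1z; have [] := @z_neq0 i.+1 isT.
have [l3 l30 h3] : exists2 l, l != 0 & ccvg (gauss_gamma gamma%:C) l.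
  apply: ccvg_gauss_gamma => i; rewrite -(rmorph_nat (real_complex R)) -rmorphD /=.
  by rewrite -[0]/(0%:C) (inj_eq (@complexI R)) lt0r_neq0 // ltr_wpDr.
rewrite z1D2 (cGamma_eq h1) (cGamma_eq h2) (cGamma_eq h3).
have h12 := ccvgM h1 h2.
(* Because Gamma(gamma) is real, [gauss_ratio] is a quotient of real parts, and its limit can be
   taken in the reals. *)
have Im3 : complex.Im l3 = 0.
  case: h3 => _; under eq_cvg do rewrite gauss_gamma_real /=.
  by move=> /(cvg_unique (@Rhausdorff R)); apply; exact: cvg_cst.
have Re3 : complex.Re l3 != 0.
  apply: contra l30 => /eqP r0; apply/eqP/eqP; rewrite eq_complex /=.
  by rewrite r0 Im3 !eqxx.
have ar : gauss_ratio n @[n --> \oo] --> complex.Re (l1 * l2) / complex.Re l3.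
  have h : complex.Re (gauss_gamma (1 + z1) n * gauss_gamma (1 + z2) n) / complex.Re (gauss_gamma gamma%:C n)
     @[n --> \oo] --> complex.Re (l1 * l2) / complex.Re l3.
    by apply: cvgM; [case: h12|apply: cvgV => //; case: h3].
  apply: near_cvg_eq h; exists 1%N => // n /= n0; rewrite gauss_ratioE //.
  have gn : gauss_gamma gamma%:C n != 0.
    apply: gauss_gamma_neq0 => i; rewrite -(rmorph_nat (real_complex R)) -rmorphD /=.
    by rewrite -[0]/(0%:C) (inj_eq (@complexI R)) lt0r_neq0 // ltr_wpDr.
  move: gn; rewrite gauss_gamma_real; set x := (X in X%:C) => gn.
  have x0 : x != 0 by apply: contra gn => /eqP ->.
  by rewrite -rmorphM /= mulfK.
set A := _ / _ in ar; exists A.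
have e : l1 * l2 = A%:C * l3.
  apply: (ccvg_unique h12).
  have [hr hi] := ccvgM (ccvgR ar) h3; split; [apply: near_cvg_eq hr|apply: near_cvg_eq hi];
    by exists 1%N => // n /= n0; rewrite gauss_ratioE.
have A0 : A != 0.
  apply: contraTneq isT => A0; move/eqP: e; rewrite A0 mul0r mulf_eq0.
  by rewrite (negbTE l10) (negbTE l20).
split => //; first by rewrite e mulfK.
move=> _; rewrite lt_neqAle eq_sym A0 -(cvg_lim (@Rhausdorff R) ar).
apply: limr_ge; first exact: (cvgP _ ar).
apply: nearW => n; rewrite /gauss_ratio divr_ge0 ?mulr_ge0 ?exprn_ge0 //.
  by rewrite ltW // poch_gt0.
by rewrite ltW // big_nat prodr_gt0 // => j /andP[j1 _]; exact: denom_gt0.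
Qed.

(** Splitting off the first factors, B(z1, z2) s1 s2 = B(z1, z2) z1 z2 = A by the functional
    equation, and (1 + s1)_k (1 + s2)_k is the real product [numer k]. Both branches of [beta_poch]
    thus agree with one real formula. *)
Lemma beta_pochE (A : R) :
  cGamma (1 + z1) * cGamma (1 + z2) / cGamma (z1 + z2) = A%:C ->
  forall k, beta_poch z1 z2 s1 s2 k.+1 = (A * numer k)%:C.
Proof.
move=> eA k; rewrite /beta_poch.
have pE : poch (1 + s1) k * poch (1 + s2) k = (numer k)%:C.
  rewrite /numer big_add1 /= big_mkord rmorph_prod /poch -big_split /=.
  by apply: eq_bigr => i _; rewrite !nat1z sc.
case: ifPn => [_|z0]; first by rewrite /= pE eA rmorphM.
have z1i (i : nat) : z1 + i%:R != 0.
  case: i => [|i]; last by have [] := @z_neq0 i.+1 isT.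
  by rewrite addr0; apply: contra z0 => /eqP ->; rewrite mul0r.
have z2i (i : nat) : z2 + i%:R != 0.
  case: i => [|i]; last by have [] := @z_neq0 i.+1 isT.
  by rewrite addr0; apply: contra z0 => /eqP ->; rewrite mulr0.
have pS (s : R[i]) : poch s k.+1 = s * poch (1 + s) k.
  rewrite /poch big_ord_recl addr0; congr (_ * _).
  by apply: eq_bigr => i _; rewrite nat1z.
rewrite !pS [X in _ * X]mulrACA s12 -z12 pE [RHS]rmorphM /= -eA.
by rewrite (cGamma_add1 z1i) (cGamma_add1 z2i) /cBeta; ring.
Qed.

(** The left side is [gauss_ratio n * numer k] times a correction tending to 1: the denominator has
    two more factors, each of order n^2, and the rising factorial k + 2 more, each of order n. *)
Lemma cvg_gnedin_v (A : R) (k : nat) : gauss_ratio @ \oo --> A ->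
  gnedin_v gamma zeta n k.+1 * n`!%:R * n%:R ^+ k @[n --> \oo] --> A * numer k.
Proof.
move=> hA; have idy : (fun n : nat => n) @ \oo --> \oo by exact: cvg_id.
have n1 : n%:R / n%:R @[n --> \oo] --> (1 : R).
  by apply: near_cvg_eq (cvg_cst _); exists 1%N => // n /= n0; rewrite divff // pnatr_eq0 -lt0n.
have close (M : nat -> nat) (d : nat) (x : R) :
    (\forall n \near \oo, (n <= M n + d)%N /\ (M n <= n + d)%N) ->
    (x + (M n)%:R) / n%:R @[n --> \oo] --> (1 : R).
  move=> hM; have h1 := cvg_ratio_close idy hM n1.
  have h2 : x * n%:R^-1 + (M n)%:R / n%:R @[n --> \oo] --> x * 0 + 1.
    by apply: cvgD; [apply: cvgM; [exact: cvg_cst|exact: (@cvg_natV R _ _ _ _ idy)]|exact: h1].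
  rewrite mulr0 add0r in h2; apply: near_cvg_eq h2; apply: nearW => n.
  by rewrite mulrDl.
have cn (M : nat -> nat) (d : nat) :
    (\forall n \near \oo, (n <= M n + d)%N /\ (M n <= n + d)%N) ->
    c (M n) / n%:R ^+ 2 @[n --> \oo] --> (1 : R).
  move=> hM; have h1 := close M d 0 hM.
  have h2 : ((0 + (M n)%:R) / n%:R) * ((0 + (M n)%:R) / n%:R) +
      (gamma * n%:R^-1) * ((0 + (M n)%:R) / n%:R) + zeta * (n%:R^-1 * n%:R^-1)
      @[n --> \oo] --> 1 * 1 + (gamma * 0) * 1 + zeta * (0 * 0).
    have v0 := @cvg_natV R _ _ _ _ idy.
    have t1 : gamma * n%:R^-1 @[n --> \oo] --> gamma * 0 by apply: cvgM; [exact: cvg_cst|exact: v0].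
    have t2 : zeta * (n%:R^-1 * n%:R^-1) @[n --> \oo] --> zeta * (0 * 0).
      by apply: cvgM; [exact: cvg_cst|apply: cvgM; exact: v0].
    apply: cvgD; last exact: t2.
    by apply: cvgD; [apply: cvgM; exact: h1|apply: cvgM; [exact: t1|exact: h1]].
  rewrite !mulr0 mul0r mul1r !addr0 in h2; apply: near_cvg_eq h2; apply: nearW => n.
  by rewrite /c !add0r expr2 -exprVn; ring.
have h : gauss_ratio n * numer k * ((c n / n%:R ^+ 2) * (c n.+1 / n%:R ^+ 2) *
    (\prod_(i < k.+2) ((gamma + (n - k.+1 + i)%N%:R) / n%:R))^-1) @[n --> \oo]
    --> A * numer k * (1 * 1 * (\prod_(i < k.+2) 1)^-1).
  apply: cvgM; first by apply: cvgM => //; exact: cvg_cst.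
  apply: cvgM; first apply: cvgM.
  - by apply: (cn (fun n => n) 0%N); apply: nearW => n; lia.
  - by apply: (cn S 1%N); apply: nearW => n; lia.
  - apply: cvgV; first by rewrite big1 ?oner_neq0.
    apply: cvg_prodR => i _; apply: (close (fun n => n - k.+1 + i)%N (k.+1 + i)%N).
    by apply: nearW => n; lia.
rewrite big1 // invr1 !mulr1 in h; apply: near_cvg_eq h.
exists k.+2 => // n /= kn.
have n0 : n%:R != 0 :> R by rewrite pnatr_eq0 -lt0n (leq_trans _ kn).
rewrite big_split /= prodr_const card_ord exprVn.
have pS : poch gamma n.+1 = poch gamma (n - k.+1) *
    \prod_(i < k.+2) (gamma + (n - k.+1 + i)%N%:R).
  rewrite /poch -!(big_mkord xpredT (fun i => gamma + i%:R)).
  rewrite (big_cat_nat (n := n - k.+1)) //=; last by lia.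
  congr (_ * _); rewrite -[X in \prod_(X <= _ < _) _]add0n big_addn.
  have -> : (n.+1 - (n - k.+1) = k.+2)%N by lia.
  by rewrite big_mkord; apply: eq_bigr => i _; rewrite addnC.
have P0 : \prod_(i < k.+2) (gamma + (n - k.+1 + i)%N%:R) != 0.
  by apply/prodf_neq0 => i _; rewrite lt0r_neq0 // ltr_wpDl // ltr0n; lia.
have cS : \prod_(1 <= j < n.+2) c j = (\prod_(1 <= j < n) c j) * c n * c n.+1.
  by rewrite !big_nat_recr //=; lia.
have cn0 : c n != 0 by rewrite lt0r_neq0 // denom_gt0 //; lia.
have cn10 : c n.+1 != 0 by rewrite lt0r_neq0 // denom_gt0.
have C0 : \prod_(1 <= j < n) c j != 0.
  by rewrite lt0r_neq0 // big_nat prodr_gt0 // => j /andP[j1 _]; exact: denom_gt0.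
rewrite /gnedin_v -/(numer k) /gauss_ratio pS cS -/(c _).
have -> : \prod_(1 <= j < n) (j%:R ^+ 2 + gamma * j%:R + zeta) = \prod_(1 <= j < n) c j by [].
have -> : n%:R ^+ k.+2 = n%:R ^+ k * n%:R ^+ 2 :> R by rewrite -exprD addn2.
have nk0 : n%:R ^+ k != 0 :> R by rewrite expf_neq0.
move: P0 cn0 cn10 C0 n0 nk0.
move: (\prod_(i < k.+2) _) (c n) (c n.+1) (\prod_(1 <= j < n) c j) (n%:R ^+ k : R) (n%:R : R) => p x y q t u.
move: (poch _ _) (numer k) (n`!%:R : R) => a b f p0 x0 y0 q0 u0 t0.
by field; rewrite p0 x0 y0 q0 u0 t0.
Qed.

End beta_constant.

(** * Total mass of the limit law *)

Section summable.
Context {R : realType} (t : nat -> R).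
Hypothesis t0 : forall i, 0 <= t i.

Lemma cvg_partial_sums (B : R) : (forall M, \sum_(0 <= i < M) t i <= B) ->
  cvgn (fun M => \sum_(0 <= i < M) t i).
Proof.
move=> hB; apply: nondecreasing_is_cvgn; last by exists B => _ [M _ <-].
apply/nondecreasing_seqP => M; rewrite big_nat_recr //= lerDl //.
Qed.

(* Otherwise the blocks of terms M <= i < 2 M would have sums bounded below. *)
Lemma cvg_mul_summable0 (L : R) : cvgn (fun M => \sum_(0 <= i < M) t i) ->
  (fun M => M%:R * t M) @ \oo --> L -> L = 0.
Proof.
move=> /cvg_ex[s hs] hL; apply/eqP; rewrite eq_le; apply/andP; split; last first.
  rewrite -(cvg_lim (@Rhausdorff R) hL); apply: limr_ge; first exact: (cvgP _ hL).
  by apply: nearW => M; rewrite mulr_ge0.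
rewrite leNgt; apply/negP => L0.
have hd : (fun M : nat => (M + M)%N) @ \oo --> \oo.
  apply/cvgnyPge => A; exists A => // n /= An; exact: leq_trans (leq_addr _ _).
have h2 : \sum_(0 <= i < M + M) t i - \sum_(0 <= i < M) t i @[M --> \oo] --> (0 : R).
  have h3 : \sum_(0 <= i < M + M) t i @[M --> \oo] --> s.
    exact: (@cvg_comp _ _ _ (fun M : nat => (M + M)%N) (fun M => \sum_(0 <= i < M) t i) _ _ _ hd hs).
  by have := cvgB h3 hs; rewrite subrr; apply.
have [N _ hN] : \forall M \near \oo, L / 2 < M%:R * t M.
  by apply: (cvgr_gt _ hL); rewrite ltr_pdivrMr //; lra.
suff : L / 4 <= 0 by apply/negP; rewrite -ltNge divr_gt0.
rewrite -(cvg_lim (@Rhausdorff R) h2); apply: limr_ge; first exact: (cvgP _ h2).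
exists N.+1 => // M /= NM.
have M0 : 0 < M%:R :> R by rewrite ltr0n (leq_trans _ NM).
rewrite (big_cat_nat (n := M)) //= ?leq_addr // [X in _ <= X]addrAC subrr add0r.
apply: (@le_trans _ _ (\sum_(M <= i < M + M) L / 4 / M%:R)).
  by rewrite sumr_const_nat addnK -[_ *+ M]mulr_natr divfK ?lt0r_neq0.
rewrite !big_nat; apply: ler_sum => i /andP[Mi iM].
have i0 : 0 < i%:R :> R by rewrite ltr0n (leq_trans _ Mi) // (leq_trans _ NM).
have /ltW h : L / 2 < i%:R * t i by apply: hN => /=; rewrite ltnW // (leq_trans NM).
rewrite -(ler_pM2l i0) (le_trans _ h) //.
rewrite mulrCA (_ : L / 2 = L / 4 * 2); last by field.
rewrite ler_wpM2l ?divr_ge0 ?(ltW L0) // ler_pdivrMr // -natrM ler_nat.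
by rewrite mul2n -addnn ltnW.
Qed.

End summable.

Section gauss_sum.
Context {R : realType} (gamma zeta : R).
Hypothesis g0 : 0 < gamma.
Hypothesis pos : forall j : nat, (1 <= j)%N ->
  0 < j%:R ^+ 2 - gamma * j%:R + zeta.

Let b : nat -> R := numer gamma zeta.
(** The i-th term of the hypergeometric series, [b i] being (1 + s1)_i (1 + s2)_i. Since (2)_i = (i
    + 1)!, [A * t 0 i] is the mass of the limit law at i + 1. *)
Let t (N i : nat) : R := b i / (i`!%:R * poch (N.+2%:R) i).
(** The quotient (c - a) (c - b) / (c (c - a - b)) of Gauss's theorem at a = 1 + s1, b = 1 + s2, c =
    N + 2. *)
Let r (N : nat) : R :=
  (N.+1%:R ^+ 2 + gamma * N.+1%:R + zeta) / (N.+2%:R * (N%:R + gamma)).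

Let poch_pos (N i : nat) : 0 < poch (N.+2%:R : R) i.
Proof. by apply: poch_gt0; rewrite ltr0n. Qed.

Let fact_pos (i : nat) : 0 < i`!%:R :> R.
Proof. by rewrite ltr0n fact_gt0. Qed.

Let t_ge0 (N i : nat) : 0 <= t N i.
Proof. by rewrite ltW // divr_gt0 ?numer_gt0 // mulr_gt0. Qed.

Let pochSr (x : R) (i : nat) : poch x i.+1 = poch x i * (x + i%:R).
Proof. by rewrite /poch big_ord_recr. Qed.

Let pochSl (N i : nat) : poch (N.+2%:R : R) i * (N.+2%:R + i%:R) = N.+2%:R * poch (N.+3%:R) i.
Proof.
rewrite -pochSr /poch big_ord_recl addr0; congr (_ * _); apply: eq_bigr => j _.
by rewrite lift0 -!natrD; congr (_%:R); lia.
Qed.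

(* Contiguity relation for 2F1(1 + s1, 1 + s2; N + 2; 1) in the third parameter,
   with its telescoping remainder. *)
Lemma gauss_sum_step (N M : nat) : \sum_(0 <= i < M) t N i
  = r N * \sum_(0 <= i < M) t N.+1 i - M%:R * t N M / (N%:R + gamma).
Proof.
have Ng : N%:R + gamma != 0 by rewrite lt0r_neq0 // ltr_wpDl.
elim: M => [|M IH]; first by rewrite !big_geq // mulr0 !mul0r subr0.
rewrite !big_nat_recr //= IH mulrDr -!addrA; congr (_ + _).
have x0 : N.+2%:R + M%:R != 0 :> R by rewrite -natrD pnatr_eq0.
have e1 : t N.+1 M = t N M * N.+2%:R / (N.+2%:R + M%:R).
  rewrite /t; apply: (mulIf x0); rewrite divfK //.
  have := pochSl N M; have := lt0r_neq0 (poch_pos N M); have := lt0r_neq0 (poch_pos N.+1 M).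
  have := lt0r_neq0 (fact_pos M).
  have n0 : N.+2%:R != 0 :> R by rewrite pnatr_eq0.
  move: (poch _ M) (poch _ M) (N.+2%:R + _) x0 => p q x x0 f0 q0 p0 e.
  have -> : q = p * x / N.+2%:R by rewrite e mulrC mulKf.
  move: (N.+2%:R : R) n0 => y n0; move: (b M) (M`!%:R : R) f0 => u f f0.
  by field; rewrite f0 p0 x0 n0.
have e2 : M.+1%:R * t N M.+1 = t N M * (M.+1%:R ^+ 2 - gamma * M.+1%:R + zeta) / (N.+2%:R + M%:R).
  rewrite /t /b /numer big_nat_recr //= -/(numer _ _ M) pochSr factS natrM.
  have := lt0r_neq0 (poch_pos N M); have := lt0r_neq0 (fact_pos M).
  have m0 : M.+1%:R != 0 :> R by rewrite pnatr_eq0.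
  move: (poch _ M) (_ + M%:R) x0 (M`!%:R : R) (M.+1%:R : R) m0 => p x x0 f m m0 f0 p0.
  by field; rewrite f0 p0 x0 m0.
rewrite e1 e2 /r.
have n0 : N.+2%:R != 0 :> R by rewrite pnatr_eq0.
move: n0 Ng x0; rewrite -!natr1; move: (N%:R : R) (M%:R : R) (t N M) => n m u n0 Ng x0.
by field; rewrite n0 Ng x0.
Qed.

Hypothesis bounded : exists B : R, forall M, \sum_(0 <= i < M) t 0 i <= B.

Let cvg_t (N : nat) : cvgn (fun M => \sum_(0 <= i < M) t N i).
Proof.
have [B hB] := bounded; apply: (@cvg_partial_sums _ _ (t_ge0 N) B) => M.
apply: le_trans (hB M); apply: ler_sum => i _.
rewrite /t ler_wpM2l ?(ltW (numer_gt0 _ _)) // lef_pV2 ?posrE ?mulr_gt0 //.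
rewrite ler_wpM2l ?(ltW (fact_pos _)) //; apply: ler_prod => j _.
by rewrite -!natrD ler0n ler_nat leq_add2r ltnS.
Qed.

Let S (N : nat) : R := limn (fun M => \sum_(0 <= i < M) t N i).

(** Both series converge, so the remainder M t_M of [gauss_sum_step] has a limit, and summability of
    t forces it to be 0. *)
Lemma gauss_sum_rec (N : nat) : S N = r N * S N.+1.
Proof.
have Ng : N%:R + gamma != 0 by rewrite lt0r_neq0 // ltr_wpDl.
have h1 := @cvg_t N; have h2 := @cvg_t N.+1.
have h : (fun M => M%:R * t N M) @ \oo --> (N%:R + gamma) * (r N * S N.+1 - S N).
  have h3 : (N%:R + gamma) * (r N * \sum_(0 <= i < M) t N.+1 i - \sum_(0 <= i < M) t N i) @[M --> \oo]
     --> (N%:R + gamma) * (r N * S N.+1 - S N).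
    apply: cvgM; first exact: cvg_cst.
    by apply: cvgB => //; apply: cvgM => //; exact: cvg_cst.
  apply: near_cvg_eq h3; apply: nearW => M; rewrite (gauss_sum_step N M).
  by rewrite subKr [RHS]mulrC divfK.
have /eqP := cvg_mul_summable0 (t_ge0 N) h1 h.
by rewrite mulf_eq0 (negbTE Ng) /= subr_eq0 => /eqP.
Qed.

Lemma S_ge1 (N : nat) : 1 <= S N.
Proof.
apply: limr_ge; first exact: cvg_t.
exists 1%N => // M /= M0; rewrite big_ltn // {1}/t /b /numer big_geq // /poch big_ord0.
by rewrite mulr1 divr1 lerDl sumr_ge0.
Qed.

Lemma gauss_sum_prod (K : nat) : S 0 = (\prod_(0 <= N < K) r N) * S K.
Proof.
elim: K => [|K IH]; first by rewrite big_geq // mul1r.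
by rewrite IH gauss_sum_rec big_nat_recr //= mulrA.
Qed.

Lemma gauss_prod_r (M : nat) : \prod_(0 <= N < M) r N =
  \prod_(1 <= j < M.+1) (j%:R ^+ 2 + gamma * j%:R + zeta)
  / ((M.+1)`!%:R * poch gamma M).
Proof.
elim: M => [|M IH].
  by rewrite !big_geq // /poch big_ord0 mulr1 divr1.
rewrite big_nat_recr //= IH [in RHS]big_nat_recr //= pochSr [in RHS]factS natrM /r.
have p0 : poch gamma M != 0 by rewrite lt0r_neq0 // poch_gt0.
have f0 : (M.+1)`!%:R != 0 :> R by rewrite lt0r_neq0.
have k2 : M.+2%:R != 0 :> R by rewrite pnatr_eq0.
have m0 : M%:R + gamma != 0 by rewrite lt0r_neq0 // ltr_wpDl.
rewrite [gamma + _]addrC.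
move: (poch _ _) (\prod_(_ <= _ < _) _) ((M.+1)`!%:R : R) p0 f0 => p c f p0 f0.
move: (M%:R + gamma) (M.+2%:R : R) m0 k2 => x y x0 y0.
by field; rewrite p0 f0 x0 y0.
Qed.

Lemma gauss_sum_ge (A : R) : 0 < A -> gauss_ratio gamma zeta @ \oo --> A ->
  1 <= A * S 0.
Proof.
move=> A0 hA.
have h : gauss_ratio gamma zeta K * S 0 @[K --> \oo] --> A * S 0.
  by apply: cvgM => //; exact: cvg_cst.
(* This product is K^2 / ((K + 1) (K + 2)), the exact value of [gauss_ratio] at K times r_0 ...
   r_K. *)
have h1 : (1 - K.+1%:R^-1) * ((1 - K.+1%:R^-1) * (1 - K.+2%:R^-1)) @[K --> \oo] --> (1 : R).
  have u1 : K.+1%:R^-1 @[K --> \oo] --> (0 : R) by exact: cvg_harmonic.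
  have u2 : K.+2%:R^-1 @[K --> \oo] --> (0 : R) by have := u1; rewrite -cvg_shiftS.
  have c1 : 1 - K.+1%:R^-1 @[K --> \oo] --> (1 - 0 : R) by apply: cvgB => //; exact: cvg_cst.
  have c2 : 1 - K.+2%:R^-1 @[K --> \oo] --> (1 - 0 : R) by apply: cvgB => //; exact: cvg_cst.
  by have := cvgM c1 (cvgM c1 c2); rewrite subr0 !mulr1; apply.
apply: (ler_cvg_to h1 h); near=> K.
have K0 : (0 < K)%N by near: K; exact: nbhs_infty_gt.
have aK : 0 < gauss_ratio gamma zeta K.
  rewrite /gauss_ratio divr_gt0 ?mulr_gt0 ?exprn_gt0 ?ltr0n ?fact_gt0 ?poch_gt0 //.
  by rewrite big_nat prodr_gt0 // => j /andP[j1 _]; apply: denom_gt0 => //; exact: ltW.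
rewrite (gauss_sum_prod K.+1).
apply: (@le_trans _ _ (gauss_ratio gamma zeta K * \prod_(0 <= N < K.+1) r N)); last first.
  rewrite mulrA ler_peMr ?S_ge1 // mulr_ge0 ?(ltW aK) // big_nat prodr_ge0 // => N _.
  apply: divr_ge0; last by rewrite mulr_ge0 // addr_ge0 // ltW.
  by apply: ltW; apply: denom_gt0 => //; exact: ltW.
rewrite gauss_prod_r /gauss_ratio.
have p0 : poch gamma K.+1 != 0 by rewrite lt0r_neq0 // poch_gt0.
have c0 : \prod_(1 <= j < K.+2) (j%:R ^+ 2 + gamma * j%:R + zeta) != 0.
  rewrite lt0r_neq0 // big_nat prodr_gt0 // => j /andP[j1 _].
  by apply: denom_gt0 => //; exact: ltW.
have f0 : K`!%:R != 0 :> R by rewrite lt0r_neq0.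
have k1 : K.+1%:R != 0 :> R by rewrite pnatr_eq0.
have k2 : K.+2%:R != 0 :> R by rewrite pnatr_eq0.
rewrite !factS !natrM le_eqVlt; apply/orP; left; apply/eqP.
move: (poch _ _) (\prod_(_ <= _ < _) _) (K`!%:R : R) p0 c0 f0 => p c f p0 c0 f0.
move: k1 k2; rewrite -!natr1; move: (K%:R : R) => k k1 k2.
by field; rewrite p0 c0 f0 k1 k2.
Unshelve. all: by end_near. Qed.

End gauss_sum.

(** * ** Asymptotic equivalences, including gamma = 0 *)

Section assembly.
Context {R : realType} (d : measure_display) (T : measurableType d)
  (P : probability T R) (gamma zeta : R)
  (Pi : forall n : nat, T -> {set {set 'I_n}}) (w : nat -> R) (A : R).
Hypothesis gamma0 : 0 <= gamma.
Hypothesis pos : forall j : nat, (1 <= j)%N ->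
  0 < j%:R ^+ 2 - gamma * j%:R + zeta.
Hypothesis HPi : gnedin_partition P gamma zeta Pi.
Hypothesis hA : gauss_ratio gamma zeta @ \oo --> A.
Hypothesis A_gt0 : 0 < gamma -> 0 < A.
Hypothesis wE : forall k, w k.+1 = A * numer gamma zeta k.

Lemma poch0 (n : nat) : (0 < n)%N -> poch (0 : R) n = 0.
Proof. by case: n => // n _; rewrite /poch big_ord_recl addr0 mul0r. Qed.

Lemma gnedin_v0 (n k : nat) : gamma = 0 -> (k.+1 < n)%N ->
  gnedin_v gamma zeta n k.+1 = 0.
Proof. by move=> g0 kn; rewrite /gnedin_v g0 poch0 ?subn_gt0 // !mul0r. Qed.

Lemma gnedin_v_ge0 (n k : nat) : (k < n)%N -> 0 <= gnedin_v gamma zeta n k.+1.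
Proof.
move=> kn; rewrite /gnedin_v -/(numer gamma zeta k).
rewrite divr_ge0 ?mulr_ge0 ?(ltW (numer_gt0 pos _)) //.
  by rewrite /poch prodr_ge0 // => i _; rewrite addr_ge0.
by rewrite big_nat prodr_ge0 // => j /andP[j1 _]; rewrite ltW // denom_gt0.
Qed.

Lemma gauss_ratio_lim0 : gamma = 0 -> A = 0.
Proof.
move=> g0; apply: (cvg_unique (@Rhausdorff R) hA).
rewrite (_ : gauss_ratio gamma zeta = fun=> 0); first exact: cvg_cst.
by apply/funext => n; rewrite /gauss_ratio g0 poch0 // mulr0 mul0r.
Qed.

Lemma cvg_v (k : nat) : gnedin_v gamma zeta n k.+1 * n`!%:R * n%:R ^+ k
  @[n --> \oo] --> w k.+1.
Proof. by rewrite wE; exact: cvg_gnedin_v. Qed.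

Lemma w_eq0 (m : nat) : gamma = 0 -> (0 < m)%N -> w m = 0.
Proof. by case: m => // k g0 _; rewrite wE gauss_ratio_lim0 // mul0r. Qed.

Lemma w_gt0 (m : nat) : 0 < gamma -> (0 < m)%N -> 0 < w m.
Proof. by case: m => // k g0 _; rewrite wE mulr_gt0 ?A_gt0 ?numer_gt0. Qed.

(** When the limit sum is nonempty and gamma > 0, its term m = 1 is w 1 > 0, so convergence gives
    equivalence. Otherwise the limit is 0 and the finite sum itself vanishes eventually: there is no
    term for x > 1, and v_{n,k} = 0 for k < n when gamma = 0. *)
Lemma equiv_prob_min_block (x : R) (n r : nat -> nat) : 0 < x ->
  n @ \oo --> \oo -> r @ \oo --> \oo ->
  (fun i => (r i)%:R : R) ~_\oo (fun i => x * (n i)%:R) ->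
  (x = 1 -> \forall i \near \oo, (r i <= n i)%N) ->
  (fun i => fine (P [set t | (r i <= min_block (Pi (n i) t))%N])) ~_\oo
  (fun=> \sum_(1 <= m < (Num.truncn x^-1).+1)
           w m / (m`!%:R * (m - 1)`!%:R) * (1 - m%:R * x) ^+ (m - 1)).
Proof.
move=> x0 ny ry rx x1; have rn := equiv_ratio ny rx.
have e : \forall i \near \oo, fine (P [set t | (r i <= min_block (Pi (n i) t))%N])
    = min_tail gamma zeta (n i) (r i).
  by apply: filterS2 (near_gt0 ny) (near_gt0 ry) => i n0 r0; rewrite (prob_min_block HPi).
have lim : fine (P [set t | (r i <= min_block (Pi (n i) t))%N]) @[i --> \oo] -->
    \sum_(1 <= m < (Num.truncn x^-1).+1)
      w m / (m`!%:R * (m - 1)`!%:R) * (1 - m%:R * x) ^+ (m - 1).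
  apply: near_cvg_eq e _; exact: (cvg_min_tail cvg_v x0 ny rn x1).
have [g0|g0] : gamma = 0 \/ 0 < gamma.
  by move: gamma0; rewrite le_eqVlt => /predU1P[->|]; [left|right].
  apply: equiv_near_eq; rewrite big_nat big1; last first.
    by move=> m /andP[m1 _]; rewrite w_eq0 // !mul0r.
  have nK : \forall i \near \oo, ((Num.truncn x^-1).+1 < n i)%N.
    by move/cvgnyPge : ny; exact.
  have h := near_min_tail gamma zeta x0 ny rn.
  apply: filterS3 e (h _) nK => i -> -> Kn.
  rewrite big_nat big1 // => k /andP[_ kK].
  by rewrite /block_coef gnedin_v0 ?mul0r // (leq_ltn_trans _ Kn) // ltnW.
have := near_min_tail gamma zeta x0 ny rn; move: lim.
case E : (Num.truncn x^-1) => [|K] lim h.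
  apply: equiv_near_eq; rewrite big_geq //.
  by apply: filterS2 e (h _) => i -> ->; rewrite big_geq.
apply: equiv_cst lim; rewrite lt0r_neq0 // big_ltn // ltr_pwDl //.
  by rewrite !mulr_gt0 ?w_gt0 // ?invr_gt0 ?mulr_gt0 ?ltr0n // expr0.
rewrite big_nat sumr_ge0 // => m /andP[m1 mK].
have mx : m%:R * x <= 1.
  rewrite -ler_pdivlMr // mul1r; apply: (@le_trans _ _ K.+1%:R); first by rewrite ler_nat.
  by rewrite -E truncn_le invr_ge0 ltW.
rewrite mulr_ge0 ?exprn_ge0 ?subr_ge0 // divr_ge0 ?mulr_ge0 //.
by rewrite ltW // w_gt0 // ltnW.
Qed.

Lemma equiv_moment (j : nat) : (0 < j)%N ->
  let moment (n : nat) : \bar R :=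
    'E_P[(fun t => (min_block (Pi n t) ^_ j)%:R / n%:R ^+ j)%R]%E in
  let u (m : nat) : R :=
    w m / (m`!%:R * (m + j - 1)`!%:R * m%:R ^+ j) in
  let c : R := j`!%:R * limn (fun N => \sum_(1 <= m < N) u m) in
  [/\ cvgn (fun N => \sum_(1 <= m < N) u m),
      (0 < gamma \/ (1 < j)%N) ->
        (fun n => fine (moment n)) ~_\oo (fun=> c),
      moment n @[n --> \oo] --> c%:E
    & c%:E = 'E_P[(fun t => inv_pow_bin j (nblocks_lim R Pi t))%R]%E].
Proof.
move=> j0 moment u c.
have ucvg := moment_is_cvg cvg_v gnedin_v_ge0 (sum_term HPi) j0.
have mE : \forall n \near \oo, moment n = (\sum_(0 <= k < n) block_coef gamma zeta n k *
      ((j`! * comb_conv j.-1 k k.+1 n.-1)%:R / n%:R ^+ j))%:E.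
  by exists 1%N => // n /= n0; exact: (moment_min_block HPi).
have mc := cvg_moment cvg_v gnedin_v_ge0 (sum_term HPi) j0.
have fmc : fine (moment n) @[n --> \oo] --> c.
  by apply: near_cvg_eq mc; apply: filterS mE => n ->.
split => //.
- move=> gj; have [g0|g0] : gamma = 0 \/ 0 < gamma.
    by move: gamma0; rewrite le_eqVlt => /predU1P[->|]; [left|right].
    have {gj} j1 : (1 < j)%N by case: gj => //; rewrite g0 ltxx.
    apply: equiv_near_eq.
    have -> : c = 0.
      rewrite /c (_ : (fun N => _) = fun=> 0).
        by rewrite (cvg_lim (@Rhausdorff R) (cvg_cst 0)) mulr0.
      apply/funext => N; rewrite big_nat big1 // => m /andP[m1 _].
      by rewrite /u w_eq0 // mul0r.
    have := mE; apply: filterS2 (nbhs_infty_gt 0) => n n0 ->.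
    rewrite /= big_nat big1 // => k /andP[_ kn].
    move: (kn); rewrite leq_eqVlt => /predU1P[kn1|kn1]; last first.
      by rewrite /block_coef gnedin_v0 // !mul0r.
    (* Only the partition into n singletons remains; its contribution contains C(0, j - 1), which is
       0 because j > 1. *)
    rewrite -kn1 /= /comb_conv divn_small // big_nat1 bin_small ?mul0n ?muln0 ?mul0r ?mulr0 //.
    by rewrite -subn1 subn_gt0.
  apply: equiv_cst fmc; rewrite lt0r_neq0 // mulr_gt0 ?ltr0n ?fact_gt0 //.
  have u_gt0 m : (0 < m)%N -> 0 < u m.
    by move=> m0; rewrite divr_gt0 ?w_gt0 // !mulr_gt0 ?exprn_gt0 ?ltr0n ?fact_gt0.
  apply: (@lt_le_trans _ _ (u 1)); first exact: u_gt0.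
  apply: limr_ge => //; exists 2%N => // N /= N2.
  rewrite big_ltn // lerDl big_nat sumr_ge0 // => m /andP[m1 _].
  by rewrite ltW // u_gt0 // ltnW.
- apply/fine_cvgP; split => //; by apply: filterS mE => n ->.
- apply/esym; apply: (expectation_inv_pow_bin HPi cvg_v) => //.
  by apply: cvgM; [exact: cvg_cst|exact: ucvg].
Qed.

(** Partial sums are probabilities, hence at most 1; this also supplies the boundedness under which
    the hypergeometric series converges. The opposite inequality is [gauss_sum_ge]. *)
Lemma sum_nblocks_mass : 0 < gamma ->
  \sum_(0 <= k < N) nblocks_mass w k.+1 @[N --> \oo] --> (1 : R).
Proof.
move=> g0; have A0 := A_gt0 g0.
pose t (k : nat) : R := numer gamma zeta k / (k`!%:R * poch (2%:R) k).
have massE k : nblocks_mass w k.+1 = A * t k.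
  rewrite /nblocks_mass wE subn1 /= /t -(poch2 R k.+1) subn1 /=.
  by rewrite -mulrA [_ * k`!%:R]mulrC.
have le1 N : A * \sum_(0 <= k < N) t k <= 1.
  rewrite mulr_sumr -lee_fin; under eq_bigr do rewrite -massE.
  by rewrite -(prob_nblocks_le HPi cvg_v) probability_le1 //; exact: (measurable_nblocks_le HPi).
have bnd : exists B : R, forall N, \sum_(0 <= k < N) t k <= B.
  by exists A^-1 => N; rewrite -[leRHS]mulr1 ler_pdivlMl.
have t0 k : 0 <= t k.
  rewrite /t ltW // divr_gt0 ?numer_gt0 // mulr_gt0 ?poch_gt0 ?ltr0n ?fact_gt0 //.
have ge1 := gauss_sum_ge g0 pos bnd A0 hA.
have [B hB] := bnd; have tc := cvg_partial_sums t0 hB.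
have h : A * \sum_(0 <= k < N) t k @[N --> \oo] --> A * limn (fun N => \sum_(0 <= k < N) t k).
  by apply: cvgM => //; exact: cvg_cst.
have e : A * limn (fun N => \sum_(0 <= k < N) t k) = 1.
  apply/le_anti; rewrite [X in _ && X]ge1 andbT -(cvg_lim (@Rhausdorff R) h).
  by apply: limr_le; [exact: (cvgP _ h)|exact: nearW].
rewrite e in h; apply: near_cvg_eq h; apply: nearW => N.
by rewrite mulr_sumr; apply: eq_bigr => k _.
Qed.

End assembly.

Unset Implicit Arguments.

Theorem corollary4p5 (R : realType) (d : measure_display)
    (T : measurableType d) (P : probability T R) (gamma zeta : R)
    (Pi : forall n : nat, T -> {set {set 'I_n}}) (z1 z2 s1 s2 : R[i]) :
  0 <= gamma ->
  (forall j : nat, (1 <= j)%N -> 0 < j%:R ^+ 2 - gamma * j%:R + zeta) ->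
  gnedin_partition P gamma zeta Pi ->
  z1 * z2 = zeta%:C -> s1 * s2 = zeta%:C ->
  z1 + z2 = gamma%:C -> - (s1 + s2) = gamma%:C ->
  let w (m : nat) : R := complex.Re (beta_poch z1 z2 s1 s2 m) in
  [/\ forall m : nat, (1 <= m)%N -> beta_poch z1 z2 s1 s2 m = (w m)%:C,
      forall (x : R) (n r : nat -> nat), 0 < x ->
        n @ \oo --> \oo -> r @ \oo --> \oo ->
        (fun i => (r i)%:R : R) ~_\oo (fun i => x * (n i)%:R) ->
        (x = 1 -> \forall i \near \oo, (r i <= n i)%N) ->
        (fun i => fine (P [set t | (r i <= min_block (Pi (n i) t))%N]))
          ~_\oo
        (fun=> \sum_(1 <= m < (Num.truncn x^-1).+1)
                 w m / (m`!%:R * (m - 1)`!%:R)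
                 * (1 - m%:R * x) ^+ (m - 1)),
      forall j : nat, (1 <= j)%N ->
        let moment (n : nat) : \bar R :=
          'E_P[(fun t => (min_block (Pi n t) ^_ j)%:R / n%:R ^+ j)%R]%E in
        let u (m : nat) : R :=
          w m / (m`!%:R * (m + j - 1)`!%:R * m%:R ^+ j) in
        let c : R := j`!%:R * limn (fun N => \sum_(1 <= m < N) u m) in
        [/\ cvgn (fun N => \sum_(1 <= m < N) u m),
            (0 < gamma \/ (1 < j)%N) ->
              (fun n => fine (moment n)) ~_\oo (fun=> c),
            moment n @[n --> \oo] --> c%:E
          & c%:E = 'E_P[(fun t => inv_pow_bin j (nblocks_lim R Pi t))%R]%E]
    & [/\ forall t, cvgn (fun n => (#|Pi n t|%:R : R)%:E),
          forall m : nat, (1 <= m)%N ->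
            P [set t | nblocks_lim R Pi t = (m%:R)%:E]
              = (w m / (m`!%:R * (m - 1)`!%:R))%:E
        & 0 < gamma -> P [set t | nblocks_lim R Pi t = +oo%E] = 0%E]].
Proof.
move=> g0 pos HPi z12 s12 z1D2 s1D2 w.
have [A [hA eA A_gt0]] := cvg_gauss_ratio g0 pos z12 z1D2.
have bE := beta_pochE g0 pos z12 s12 z1D2 s1D2 eA.
have wE k : w k.+1 = A * numer gamma zeta k by rewrite /w bE.
have hv := cvg_v g0 pos hA wE.
split.
- by case=> // k _; rewrite /w bE.
- move=> x n r x0 ny ry rx x1.
  exact: (equiv_prob_min_block g0 pos HPi hA A_gt0 wE).
- by move=> j j1; exact: (equiv_moment g0 pos HPi hA A_gt0 wE).
- split.
  + exact: (nblocks_is_cvg HPi).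
  + by move=> m m1; rewrite (prob_nblocks_eq HPi hv).
  + move=> gp; apply: (prob_nblocks_infty HPi hv).
    exact: (sum_nblocks_mass g0 pos HPi hA A_gt0 wE).
Qed.
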